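(* Let $A,B,C,D\in\mathbb{C}[y]$ with $AD-BC\neq 0$ and let $f=\left(\frac{A(y)x+B(y)}{C(y)x+D(y)},y\right)$ be a Jonquières twist that preserves fiberwise the fibration. Let $M_f=\begin{pmatrix}A&B\\ C&D\end{pmatrix}$ and let $\chi_f(X)=X^2-\mathrm{Tr}(M_f)X+\det(M_f)$ be its characteristic polynomial. Assume that $\chi_f$ has two distinct roots in $\mathbb{C}[y]$. Then there exists a conjugate $g$ of $f$ such that $g\in\mathrm{J}_m$ and $\deg(g)\leq\deg(f)$. For instance, $g=\left(\frac{\mathrm{Tr}(M_f)+\delta_f}{\mathrm{Tr}(M_f)-\delta_f}\,x,\,y\right)$, where $\delta_f^2=\mathrm{Tr}(M_f)^2-4\det(M_f)$, has these properties.
   Context: $\mathrm{Bir}(\mathbb{P}^2_{\mathbb{C}})$ is the group of birational self-maps of the complex projective plane; maps are written in an affine chart with coordinates $(x,y)$. A birational map can be written $(x:y:z)\dashrightarrow(P_0:P_1:P_2)$ with $P_i$ homogeneous of the same degree without common factor; this degree is the degree $\deg$ of the map. ''Conjugate'' means conjugate in $\mathrm{Bir}(\mathbb{P}^2_{\mathbb{C}})$. A Jonquières twist is an $f\in\mathrm{Bir}(\mathbb{P}^2_{\mathbb{C}})$ such that $(\deg(f^k))_{k\in\mathbb{N}}$ grows linearly. ''Preserves fiberwise the fibration'' means that $f$ preserves every fiber $y=\text{const}$, i.e. $f$ has the form displayed in the claim. $\mathrm{J}_m=\{(b(y)x,y)\mid b\in\mathbb{C}(y)^*\}$. *)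

(* Defs.v *)
From HB Require Import structures.
From mathcomp Require Import all_boot all_order all_algebra.
From mathcomp Require Import classical_sets reals complex mpoly ring.

Set Implicit Arguments.
Unset Strict Implicit.
Unset Printing Implicit Defensive.

Import Order.TTheory GRing.Theory Num.Theory.
Local Open Scope ring_scope.

Section Bir.
Variable R : realType.
Local Notation C := R[i].

(* Rational self-maps of P^2 are handled through triples (P_0 : P_1 : P_2) of
   polynomials in the homogeneous coordinates x = 'X_0, y = 'X_1, z = 'X_2.
   The triples of one map are proportional over C(x, y, z), see [same_map]. *)
Definition triple := 3.-tuple {mpoly C[3]}.

Definition homog_triple (d : nat) (P : triple) : Prop :=
  forall i, tnth P i \is d.-homog.

(* The zero polynomial is d-homogeneous for every d. *)
Definition rational_map (P : triple) : Prop :=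
  (exists d, homog_triple d P) /\ (exists i, tnth P i != 0).

Definition same_map (P Q : triple) : Prop :=
  [/\ rational_map P, rational_map Q &
      forall i j, tnth P i * tnth Q j = tnth P j * tnth Q i].

Definition id_map : triple := [tuple 'X_i | i < 3].

(* The triple of P o Q; it is the zero triple, hence not a [rational_map], when
   the image of Q lies in the base locus of P. *)
Definition comp_map (P Q : triple) : triple := [tuple tnth P i \mPo Q | i < 3].

Definition iter_map (k : nat) (P : triple) : triple :=
  iter k (comp_map P) id_map.

Definition inverse_maps (P Q : triple) : Prop :=
  [/\ rational_map P, rational_map Q,
      same_map (comp_map P Q) id_map & same_map (comp_map Q P) id_map].

Definition birational (P : triple) : Prop := exists Q, inverse_maps P Q.

Definition conjugate (f g : triple) : Prop :=
  exists h h', inverse_maps h h' /\ same_map g (comp_map h (comp_map f h')).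

Definition no_common_factor (P : triple) : Prop :=
  forall q : {mpoly C[3]},
    (forall i, exists r, tnth P i = r * q) -> q \is a GRing.unit.

Definition has_degree (P : triple) (d : nat) : Prop :=
  exists Q, [/\ same_map P Q, homog_triple d Q & no_common_factor Q].

(* The d with [has_degree P d], which exists and is unique for a
   [rational_map]. *)
Definition deg (P : triple) : nat := xget 0%N [set d | has_degree P d].

(* (deg (f^k))_k grows linearly: it is bounded above and below by positive
   multiples of k. *)
Definition jonquieres_twist (f : triple) : Prop :=
  birational f /\
  exists a b : R, [/\ 0 < a, 0 < b &
    forall k : nat, (0 < k)%N ->
      a * k%:R <= (deg (iter_map k f))%:R <= b * k%:R].

(* C(y), with y = 'X, and C(x, y) = C(y)(x), with x = 'X. *)
Definition ratfun_y : fieldType := {fraction {poly C}}.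
Definition ratfun_xy : fieldType := {fraction {poly ratfun_y}}.

Definition in_x (b : ratfun_y) : ratfun_xy := tofrac b%:P.
Definition in_y (p : {poly C}) : ratfun_y := tofrac p.
Definition xvar : ratfun_xy := tofrac 'X.
Definition yvar : ratfun_xy := in_x (in_y 'X).

(* P(x, y, 1) *)
Definition dehomog (p : {mpoly C[3]}) : ratfun_xy :=
  mmap (fun c : C => in_x (in_y c%:P)) (tnth [tuple xvar; yvar; 1]) p.

(* The map P is (x, y) |-> (u, v) in the chart (x, y) = (x : y : 1). *)
Definition affine_form (P : triple) (u v : ratfun_xy) : Prop :=
  let p i := dehomog (tnth P i) in
  [/\ p ord_max != 0, u = p 0 / p ord_max & v = p 1 / p ord_max].

Definition in_Jm (g : triple) : Prop :=
  birational g /\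
  exists b : ratfun_y, b != 0 /\ affine_form g (in_x b * xvar) yvar.

End Bir.

Definition mx22 (S : Type) (a b c d : S) : 'M[S]_2 :=
  \matrix_(i < 2, j < 2)
    if i == 0 then (if j == 0 then a else b) else (if j == 0 then c else d).

Definition chi (S : comNzRingType) (M : 'M[S]_2) : {poly S} :=
  'X^2 - (\tr M)%:P * 'X + (\det M)%:P.

Lemma char_poly2 (S : comNzRingType) (M : 'M[S]_2) : char_poly M = chi M.
Proof.
rewrite /char_poly /chi /mxtrace !(expand_det_row _ ord0) !big_ord_recl !big_ord0.
rewrite /cofactor !det_mx11 !mxE /=.
have -> : lift ord0 (0 : 'I_1) = 1 by exact: val_inj.
have -> : lift 1 (0 : 'I_1) = 0 :> 'I_2 by exact: val_inj.
rewrite !(expr0, expr1, mulr0n, mulr1n) !(polyCD, polyCM, polyCN).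
ring.
Qed.

(* Main.v *)
From HB Require Import structures.
Require Import Defs.
From mathcomp Require Import all_boot all_order all_algebra.
From mathcomp Require Import boolp reals complex mpoly.
From mathcomp Require Import ring zify.

Set Implicit Arguments.
Unset Strict Implicit.
Unset Printing Implicit Defensive.

Import Order.TTheory GRing.Theory Num.Theory.
Local Open Scope ring_scope.

(* Two distinct eigenvalues r1, r2 in C[y] give eigenvectors over C[y], and the
   matrix P that they form conjugates f to g = (r1/r2 x, y).  Writing
   r1/r2 = p/q in lowest terms, deg g = max(deg p, deg q) + 1.  For the degree
   of f, take a homogeneous triple F of degree d defining f, and set z = 1.
   Gauss' lemma yields M_f = e M' with F = t (A'x + B', y (C'x + D'), C'x + D')
   for polynomials e in y and t in x, y; hence A', D' have degree < d, B' has
   degree <= d and C' has degree < d - 1.  The eigenvalues of M' are r1/e and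
   r2/e; their sum has degree < d and their product degree <= 2d - 2, so both
   have degree < d, whence deg g <= d. *)

(** The entries of M_f may share a factor that inflates the eigenvalues without changing f, so the
    degree of f controls them only after this factor [e] has been split off. No factorization theory
    in K[x, y] is needed for that. At z = 1, let u and v be the third and first coordinates of F.
    From (Ax + B) u = (Cx + D) v one gets det(M_f) u = s (Cx + D) and det(M_f) v = s (Ax + B) with s
    = A u - C v. Hence only the factors of det(M_f) have to be distributed, and this is a polynomial
    in y alone, a product of linear factors over an algebraically closed field. *)

(** * Multivariate polynomials: homogeneity, substitution of one variable, leading forms *)

Section Mpoly.
Variables (K : fieldType) (n : nat).
Implicit Types (p q r : {mpoly K[n]}).

Lemma homog_comp k (Q : n.-tuple {mpoly K[k]}) d e p :
  p \is d.-homog -> (forall i, tnth Q i \is e.-homog) ->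
  p \mPo Q \is (e * d).-homog.
Proof.
move=> /dhomogP hp hQ; rewrite comp_mpolyE big_seq.
apply: rpred_sum => m hm; apply: rpredZ.
have <- : (\sum_(i < n) e * m i)%N = (e * d)%N.
  by rewrite -big_distrr /= -mdegE; congr (_ * _)%N; apply: hp.
by elim/big_rec2: _ => [|i a b _ h]; [exact: dhomog1 | apply: dhomogM; first exact: dhomogMn].
Qed.

(** Both sides are the value of [p] at one and the same triple, since a form of degree [d] scales by
    [d]-th powers. This exchanges proportional triples without dividing. *)
Lemma homog_comp_prop k (P Q : n.-tuple {mpoly K[k]}) a b d p :
  p \is d.-homog -> (forall i, tnth P i * b = tnth Q i * a) ->
  (p \mPo P) * b ^+ d = (p \mPo Q) * a ^+ d.
Proof.
move=> /dhomogP hp hPQ; rewrite !comp_mpolyE !mulr_suml.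
apply: eq_big_seq => m hm; rewrite -!scalerAl; congr (_ *: _).
rewrite -(hp _ hm) /= mdegE -!prodrXr -!big_split /=.
by apply: eq_bigr => i _; rewrite -!exprMn hPQ.
Qed.

(** Evaluation of one variable, kept as an endomorphism of the same ring. Its kernel is generated by
    ['X_i - c], so divisibility by this prime becomes the vanishing of a substitution. *)
Definition subst_var (i : 'I_n) (c : K) : n.-tuple {mpoly K[n]} :=
  [tuple if j == i then c%:MP else 'X_j | j < n].

Lemma comp_subst_var i c j :
  'X_j \mPo subst_var i c = if j == i then c%:MP else 'X_j.
Proof. by rewrite comp_mpolyXU -tnth_nth tnth_mktuple. Qed.

(** The property is stable under sums and products and holds for constants and variables. *)
Lemma subst_varP i c p :
  exists r, p = p \mPo subst_var i c + ('X_i - c%:MP) * r.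
Proof.
pose S p := exists r, p = p \mPo subst_var i c + ('X_i - c%:MP) * r.
have SD q1 q2 : S q1 -> S q2 -> S (q1 + q2).
  case=> r1 e1 [r2 e2]; exists (r1 + r2).
  by rewrite rmorphD /= {1}e1 {1}e2; ring.
have SM q1 q2 : S q1 -> S q2 -> S (q1 * q2).
  case=> r1 e1 [r2 e2]; exists (r1 * q2 + (q1 \mPo subst_var i c) * r2).
  rewrite rmorphM /= {1}e1 mulrDl {1}e2; ring.
have SC a : S a%:MP by exists 0; rewrite comp_mpolyC mulr0 addr0.
have SX j : S 'X_j.
  rewrite /S comp_subst_var; case: eqP => [->|_]; last by exists 0; rewrite mulr0 addr0.
  by exists 1; ring.
have SXn j k : S ('X_j ^+ k).
  by elim: k => [|k IH]; [rewrite expr0 -mpolyC1 | rewrite exprS; apply: SM].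
have SXm m : S 'X_[m].
  by rewrite mpolyXE_id; apply: big_ind => //; rewrite -mpolyC1.
rewrite -/(S p) (mpolyE p); apply: big_ind => // [|m _]; first by rewrite -mpolyC0.
by rewrite -mul_mpolyC; apply: SM.
Qed.

Lemma subst_var_dvd i c p :
  p \mPo subst_var i c = 0 -> exists r, p = ('X_i - c%:MP) * r.
Proof. by move=> h; have [r e] := subst_varP i c p; exists r; rewrite {1}e h add0r. Qed.

Lemma subst_varXB i c : ('X_i - c%:MP) \mPo subst_var i c = 0 :> {mpoly K[n]}.
Proof. by rewrite rmorphB /= comp_subst_var eqxx comp_mpolyC subrr. Qed.

Lemma var_prime i p q r :
  'X_i * r = p * q -> p \mPo subst_var i 0 != 0 -> exists t, q = 'X_i * t.
Proof.
move=> e hp.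
have X0 : ('X_i : {mpoly K[n]}) = 'X_i - 0%:MP by rewrite mpolyC0 subr0.
have /eqP : (p * q) \mPo subst_var i 0 = 0 by rewrite -e X0 rmorphM /= subst_varXB mul0r.
rewrite rmorphM /= mulf_eq0 (negbTE hp) /= => /eqP /subst_var_dvd[t ->].
by exists t; rewrite -X0.
Qed.

Lemma mpolyX_neq0 (m : 'X_{1..n}) : 'X_[m] != 0 :> {mpoly K[n]}.
Proof. by rewrite -msupp_eq0 msuppX. Qed.

Lemma varX_prime i p q r k :
  'X_i ^+ k * r = p * q -> p \mPo subst_var i 0 != 0 ->
  exists t, q = 'X_i ^+ k * t.
Proof.
move=> + hp; elim: k q r => [|k IH] q r e; first by exists q; rewrite expr0 mul1r.
have [t et] := var_prime (etrans (mulrA _ _ _) (etrans (f_equal ( *%R^~ r) (esym (exprS _ k))) e)) hp.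
have e2 : 'X_i ^+ k * r = p * t.
  apply: (mulfI (mpolyX_neq0 U_(i)%MM)); rewrite mulrA -exprS e et.
  by ring.
have [u eu] := IH _ _ e2.
by exists u; rewrite et eu exprS mulrA.
Qed.

Lemma dhomog_msize_le d p : p \is d.-homog -> (msize p <= d.+1)%N.
Proof.
move=> /dhomogP h; rewrite msizeE big_seq.
by apply/bigmax_leqP_seq => m /h /= ->.
Qed.

Lemma dhomog_msize_eq0 d p : p \is d.-homog -> (msize p <= d)%N -> p = 0.
Proof.
move=> /dhomogP h hs; apply/eqP/contraT => /mlead_supp hm.
by have := msize_mdeg_lt hm; rewrite (h _ hm) ltnNge hs.
Qed.

Lemma msizeM_leq a b p q :
  (msize p <= a.+1)%N -> (msize q <= b)%N -> (msize (p * q) <= a + b)%N.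
Proof.
have [->|p0] := eqVneq p 0; first by rewrite mul0r msize0.
have [->|q0] := eqVneq q 0; first by rewrite mulr0 msize0.
move=> ha hb; rewrite msizeM // -ltnS prednK ?addn_gt0 ?lt0n ?msize_poly_eq0 ?p0 //.
by rewrite -addSn leq_add.
Qed.

Lemma msize_subr_pihomog e p :
  (msize p <= e.+1)%N -> (msize (p - pihomog mdeg e p) <= e)%N.
Proof.
move=> h; rewrite {1}(pihomog_partitionE h) big_ord_recr /= addrK.
apply: leq_trans (mmeasure_sum _ _ _ _) _.
apply/bigmax_leqP => i _; apply: leq_trans (dhomog_msize_le (pihomogP _ _ _)) _.
exact: ltn_ord.
Qed.

(** Any factorization of a form can be replaced by that of the leading forms. This keeps triples
    homogeneous when a common factor is divided out. *)
Lemma homog_factor d e p q r :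
  p \is d.-homog -> p = r * q -> q != 0 -> msize q = e.+1 ->
  p = pihomog mdeg (d - e) r * pihomog mdeg e q.
Proof.
move=> hp epq q0 eq; have [r0|r0] := eqVneq r 0.
  by rewrite epq r0 raddf0 !mul0r.
have pn0 : p != 0 by rewrite epq mulf_neq0.
have pd : msize p = d.+1.
  apply/eqP; rewrite eqn_leq dhomog_msize_le // ltnNge.
  by apply: contra pn0 => /(dhomog_msize_eq0 hp) ->.
have r0' : (0 < msize r)%N by rewrite lt0n msize_poly_eq0.
have edr : msize r = (d - e).+1.
  move: pd; rewrite {1}epq msizeM // eq; case: (msize r) r0' => // s _.
  by rewrite addSn /= addnS => -[<-]; rewrite addnK.
have led : (e <= d)%N.
  by move: pd; rewrite {1}epq msizeM // eq edr addSn /= addnS => -[<-]; rewrite leq_addl.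
apply/eqP; rewrite -subr_eq0; apply/eqP; apply: (@dhomog_msize_eq0 d).
  apply: rpredB => //.
  by have := dhomogM (pihomogP mdeg (d - e) r) (pihomogP mdeg e q); rewrite subnK.
set r' := pihomog _ _ r; set q' := pihomog _ _ q.
(* Removing the leading form lowers the degree, so both summands have degree below [d]; a form of
   degree [d] with this property is zero. *)
have -> : p - r' * q' = r' * (q - q') + q * (r - r') by rewrite epq; ring.
apply: leq_trans (mmeasureD_le _ _ _) _; rewrite geq_max; apply/andP; split.
  rewrite -(subnK led); apply: msizeM_leq; first exact/dhomog_msize_le/pihomogP.
  by apply: msize_subr_pihomog; rewrite eq.
rewrite -(subnKC led); apply: msizeM_leq; first by rewrite eq.
by apply: msize_subr_pihomog; rewrite edr.
Qed.

End Mpoly.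

Lemma ord3_ind (P : 'I_3 -> Prop) : P 0 -> P 1 -> P ord_max -> forall i, P i.
Proof.
move=> P0 P1 P2 [[|[|[|//]]] hi].
- by rewrite (_ : Ordinal hi = 0) //; apply: val_inj.
- by rewrite (_ : Ordinal hi = 1) //; apply: val_inj.
- by rewrite (_ : Ordinal hi = ord_max) //; apply: val_inj.
Qed.

Lemma cross_mul (A : idomainType) (a b p q r s : A) :
  a != 0 -> p * b = q * a -> r * b = s * a -> p * s = r * q.
Proof.
move=> a0 e1 e2; apply: (mulIf a0).
by rewrite -mulrA -e2 -[RHS]mulrA -e1; ring.
Qed.

(** * Rational maps of the plane over a field *)

Module FieldMaps.

(* Over [R[i]] these definitions are convertible to those of [Defs]. *)
Section Definitions.
Variable K : fieldType.

Definition triple := 3.-tuple {mpoly K[3]}.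

Definition homog_triple (d : nat) (P : triple) : Prop :=
  forall i, tnth P i \is d.-homog.

Definition rational_map (P : triple) : Prop :=
  (exists d, homog_triple d P) /\ (exists i, tnth P i != 0).

Definition same_map (P Q : triple) : Prop :=
  [/\ rational_map P, rational_map Q &
      forall i j, tnth P i * tnth Q j = tnth P j * tnth Q i].

Definition id_map : triple := [tuple 'X_i | i < 3].

Definition comp_map (P Q : triple) : triple := [tuple tnth P i \mPo Q | i < 3].

Definition inverse_maps (P Q : triple) : Prop :=
  [/\ rational_map P, rational_map Q,
      same_map (comp_map P Q) id_map & same_map (comp_map Q P) id_map].

Definition birational (P : triple) : Prop := exists Q, inverse_maps P Q.

Definition conjugate (f g : triple) : Prop :=
  exists h h', inverse_maps h h' /\ same_map g (comp_map h (comp_map f h')).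

Definition no_common_factor (P : triple) : Prop :=
  forall q : {mpoly K[3]},
    (forall i, exists r, tnth P i = r * q) -> q \is a GRing.unit.

Definition has_degree (P : triple) (d : nat) : Prop :=
  exists Q, [/\ same_map P Q, homog_triple d Q & no_common_factor Q].

End Definitions.

Section Maps.
Variable K : fieldType.
Implicit Types (P Q S f g h : triple K).

Lemma tnth_id_map i : tnth (id_map K) i = 'X_i.
Proof. by rewrite tnth_mktuple. Qed.

Lemma tnth_comp_map P Q i : tnth (comp_map P Q) i = tnth P i \mPo Q.
Proof. by rewrite tnth_mktuple. Qed.

Lemma same_map_neq0 P Q i : same_map P Q -> tnth P i != 0 -> tnth Q i != 0.
Proof.
move=> [_ [_ [j Qj]] e] Pi; apply: contra Qj => /eqP Qi.
have /eqP := e i j; rewrite Qi mulr0 mulf_eq0 => /orP[h|//].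
by rewrite h in Pi.
Qed.

Lemma same_map_sym P Q : same_map P Q -> same_map Q P.
Proof. by move=> [hP hQ e]; split=> // i j; rewrite mulrC -e mulrC. Qed.

Lemma same_map_trans P Q S : same_map P Q -> same_map Q S -> same_map P S.
Proof.
move=> hPQ hQS; have [hP [_ [k Qk]] e] := hPQ; have [_ hS e'] := hQS.
split=> // i j; apply: (mulfI Qk).
transitivity ((tnth P i * tnth Q k) * tnth S j); first by ring.
rewrite e; transitivity (tnth P k * (tnth Q i * tnth S j)); first by ring.
rewrite e'; transitivity ((tnth P k * tnth Q j) * tnth S i); first by ring.
by rewrite -e; ring.
Qed.

Lemma homog_comp_map P Q d e :
  homog_triple d P -> homog_triple e Q -> homog_triple (e * d) (comp_map P Q).
Proof. by move=> hP hQ i; rewrite tnth_comp_map; apply: homog_comp. Qed.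

Lemma homog_comp_same P Q d p i :
  p \is d.-homog -> same_map P Q ->
  (p \mPo P) * tnth Q i ^+ d = (p \mPo Q) * tnth P i ^+ d.
Proof.
move=> hp [_ _ e]; apply: homog_comp_prop => // j.
by rewrite e mulrC.
Qed.

Lemma homog_comp_eq0 P Q d p :
  p \is d.-homog -> same_map P Q -> p \mPo P = 0 -> p \mPo Q = 0.
Proof.
move=> hp hPQ e; have [[_ [k Pk]] _ _] := hPQ.
have /esym/eqP := homog_comp_same k hp hPQ.
by rewrite e mul0r mulf_eq0 expf_eq0 (negbTE Pk) andbF orbF => /eqP.
Qed.

Lemma rational_comp_same S P Q :
  rational_map (comp_map S P) -> rational_map S -> same_map P Q ->
  rational_map (comp_map S Q).
Proof.
move=> [_ [k Pk]] [[d hS] _] hPQ; have [_ [[e hQ] _] _] := hPQ.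
split; first by exists (e * d)%N; apply: homog_comp_map.
exists k; move: Pk; rewrite !tnth_comp_map; apply: contra => /eqP h; apply/eqP.
exact: (homog_comp_eq0 (hS k) (same_map_sym hPQ) h).
Qed.

Lemma same_map_compr S P Q :
  rational_map (comp_map S P) -> rational_map S -> same_map P Q ->
  same_map (comp_map S P) (comp_map S Q).
Proof.
move=> hSP hS hPQ; have hSQ := rational_comp_same hSP hS hPQ.
have [[d hd] _] := hS; have [[_ [k Pk]] _ _] := hPQ.
split=> // i j; rewrite !tnth_comp_map.
have Pkd : tnth P k ^+ d != 0 by rewrite expf_neq0.
have := homog_comp_same k (hd i) hPQ; have := homog_comp_same k (hd j) hPQ.
move=> ej ei.
exact: (cross_mul Pkd ei ej).
Qed.

Lemma same_map_compl S P Q :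
  rational_map (comp_map P S) -> rational_map (comp_map Q S) -> same_map P Q ->
  same_map (comp_map P S) (comp_map Q S).
Proof.
move=> hPS hQS [_ _ e]; split=> // i j; rewrite !tnth_comp_map.
by rewrite -!rmorphM /= e.
Qed.

Lemma comp_mapA P Q S : comp_map P (comp_map Q S) = comp_map (comp_map P Q) S.
Proof.
apply: eq_from_tnth => i; rewrite !tnth_comp_map.
rewrite [tnth P i \mPo Q]comp_mpolyE comp_mpolyE raddf_sum /=; apply: eq_bigr => m _.
rewrite comp_mpolyZ; congr (_ *: _); rewrite rmorph_prod /=.
by apply: eq_bigr => j _; rewrite rmorphXn /= tnth_comp_map.
Qed.

(** A birational map is dominant: if [p] vanished on the image of [h], it would vanish on
    [comp_map h h'], hence on the proportional triple [id_map]. *)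
Lemma comp_inverse_neq0 h h' d (p : {mpoly K[3]}) :
  inverse_maps h h' -> p \is d.-homog -> p != 0 -> p \mPo h != 0.
Proof.
move=> [_ _ hhh' _] hp; apply: contra => /eqP p0.
(* Associativity of composition is available for triples, so [p] is repeated three times. *)
pose P : triple K := [tuple p | i < 3].
have E : p \mPo comp_map h h' = 0.
  have := f_equal (fun t : triple K => tnth t 0) (comp_mapA P h h').
  by rewrite !tnth_comp_map !tnth_mktuple p0 raddf0.
by have := homog_comp_eq0 hp hhh' E; rewrite comp_mpoly_id => ->.
Qed.

Lemma rational_comp_birational P h :
  rational_map P -> birational h -> rational_map (comp_map P h).
Proof.
move=> [[d hP] [k Pk]] [h' hh']; have [[[e he] _] _ _ _] := hh'; split.
  by exists (e * d)%N; apply: homog_comp_map.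
by exists k; rewrite tnth_comp_map; apply: comp_inverse_neq0 hh' (hP k) Pk.
Qed.

Lemma inverse_maps_sym h h' : inverse_maps h h' -> inverse_maps h' h.
Proof. by case. Qed.

(** [deg] is a choice with default value 0, so this existence is what gives it meaning. A
    nonconstant common factor is divided out through leading forms, which lowers the degree. *)
Lemma has_degree_exists P : rational_map P -> exists d, has_degree P d.
Proof.
move=> hP; have [[d hd] _] := hP.
have : same_map P P by split=> // i j; rewrite mulrC.
(* The map [P] stays fixed while its homogeneous representative [Q] varies. *)
move: hd; move: {1 3}P => Q; move: Q; elim/ltn_ind: d => d IH Q hd hPQ.
have [hQ|hQ] := pselect (no_common_factor Q); first by exists d, Q.
have [_ [_ [k Qk]] ePQ] := hPQ.
have [q hq] : exists q : {mpoly K[3]},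
    (forall i, exists r, tnth Q i = r * q) /\ q \isn't a GRing.unit.
  apply: contrapT => hn; apply: hQ => q hq; apply: contrapT => hu; apply: hn.
  by exists q; split=> //; apply/negP.
case: hq => hq nu; have [r hr] := choice hq.
have q0 : q != 0 by apply: contra Qk => /eqP q0; rewrite hr q0 mulr0.
have [[|e] eq] : exists e, msize q = e.+1.
- by exists (msize q).-1; rewrite prednK // lt0n msize_poly_eq0.
- case/negP: nu; have /eqP/msize_poly1P[c c0 ->] := eq.
  by rewrite rmorph_unit // unitfE.
pose r' i := pihomog mdeg (d - e.+1) (r i); pose q' := pihomog mdeg e.+1 q.
have eQ i : tnth Q i = r' i * q' by apply: homog_factor (hd i) (hr i) q0 eq.
have [q'0 r'k] : q' != 0 /\ r' k != 0.
  by move: Qk; rewrite eQ mulf_eq0 negb_or => /andP[].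
have hQ' : homog_triple (d - e.+1) [tuple r' i | i < 3].
  by move=> i; rewrite tnth_mktuple pihomogP.
(* With truncated subtraction, [d - e.+1] is smaller than [d] only for positive [d]. If [d] were 0,
   a nonzero constant would be a multiple of the nonconstant [q']. *)
have ed : (0 < d)%N.
  rewrite lt0n; apply/eqP => d0; move: (hd k); rewrite d0 => hQk0.
  have := dhomog_msize_le hQk0; rewrite eQ.
  rewrite msizeM // [msize q'](_ : _ = e.+2) ?addnS /=.
    by rewrite ltnS leqn0 addn_eq0 msize_poly_eq0 (negbTE r'k).
  apply/eqP; rewrite eqn_leq dhomog_msize_le ?pihomogP // ltnNge.
  by apply: contra q'0 => /(dhomog_msize_eq0 (pihomogP _ _ _))/eqP.
apply: (IH (d - e.+1)%N _ _ hQ'); first by rewrite ltn_subrL.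
case: hPQ => hP' _ _; split=> //.
  by split; [exists (d - e.+1)%N | exists k; rewrite tnth_mktuple].
move=> i j; rewrite !tnth_mktuple; apply: (mulIf q'0).
by rewrite -!mulrA -!eQ ePQ.
Qed.

End Maps.

(** * Homogenization and fibered Moebius maps *)

Section Dehomogenization.
Variables (K : fieldType) (L : comNzRingType) (iota : {rmorphism {poly K} -> L}).
Variable X : L.
Hypothesis X_transc : forall q : {poly {poly K}}, (map_poly iota q).[X] = 0 -> q = 0.

(** Setting z = 1 is needed with several targets: K[y][x] to test identities, K[x, y, z] itself to
    measure degrees, K[y] to give x a value, and the function field. Hence the parameters [iota] and
    [X]. *)
Definition dehom (p : {mpoly K[3]}) : L :=
  mmap (iota \o polyC) (tnth [tuple X; iota 'X; 1]) p.

HB.instance Definition _ := GRing.RMorphism.copy dehom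
  (mmap (iota \o polyC) (tnth [tuple X; iota 'X; 1])).

Lemma dehomZ c p : dehom (c *: p) = iota c%:P * dehom p.
Proof. exact: mmapZ. Qed.

Lemma dehomX0 : dehom 'X_0 = X.
Proof. by rewrite /dehom mmapX mmap1U. Qed.

Lemma dehomX1 : dehom 'X_1 = iota 'X.
Proof. by rewrite /dehom mmapX mmap1U. Qed.

Lemma dehomX2 : dehom 'X_ord_max = 1.
Proof. by rewrite /dehom mmapX mmap1U. Qed.

(** In a form of degree [d] the exponents of x and y determine that of z, so distinct monomials stay
    distinct at z = 1. *)
Lemma dehom_inj d p : p \is d.-homog -> dehom p = 0 -> p = 0.
Proof.
move=> /dhomogP hp; pose i2 : 'I_3 := ord_max.
pose q : {poly {poly K}} :=
  \sum_(m <- msupp p) (p@_m *: 'X^(m 1)) *: 'X^(m 0).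
have -> : dehom p = (map_poly iota q).[X].
  rewrite /dehom /mmap /q rmorph_sum horner_sum; apply: eq_bigr => m _ /=.
  rewrite /mmap1 !big_ord_recl big_ord0 map_polyZ /= hornerZ map_polyXn hornerXn.
  rewrite -mul_polyC rmorphM rmorphXn /= mulr1.
  rewrite [tnth _ (lift _ (lift _ _))](_ : _ = 1) // expr1n mulr1.
  rewrite -mulrA; congr (_ * _); rewrite mulrC; congr (_ ^+ _ * _ ^+ _) => //.
    by congr (m _); apply: val_inj.
move/X_transc => q0; apply/eqP/contraT => pn0.
have hm := mlead_supp pn0; set m := mlead p in hm.
have : q`_(m 0)`_(m 1) = p@_m.
  rewrite /q coef_sum coef_sum (big_rem m) //= !coefZ coefXn eqxx mulr1.
  rewrite coefZ coefXn eqxx mulr1 big1_seq ?addr0 // => m' /andP[_].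
  rewrite mem_rem_uniq ?msupp_uniq // => /andP[/= nm hm'].
  rewrite coefZ coefXn; case: eqP => [e0|]; last by rewrite mulr0 coef0.
  rewrite mulr1 coefZ coefXn; case: eqP => [e1|]; last by rewrite mulr0.
  case/eqP: nm; apply/mnmP; apply: ord3_ind => //.
  have := hp _ hm'; rewrite -(hp _ hm) /= !mdegE !big_ord_recl !big_ord0 !addn0.
  have -> : lift ord0 (ord0 : 'I_2) = 1 by apply: val_inj.
  have -> : lift ord0 (lift ord0 (ord0 : 'I_1)) = i2 by apply: val_inj.
  by rewrite -e0 -e1 => /addnI /addnI.
rewrite q0 !coef0 => /esym/eqP.
by rewrite mcoeff_eq0 hm.
Qed.

Lemma dehom_inj_eq d p q :
  p \is d.-homog -> q \is d.-homog -> dehom p = dehom q -> p = q.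
Proof.
move=> hp hq e; apply/eqP; rewrite -subr_eq0; apply/eqP.
by apply: (@dehom_inj d); rewrite ?rpredB // raddfB /= e subrr.
Qed.

End Dehomogenization.

Lemma size_mul_bound (A : nzSemiRingType) n m (p q : {poly A}) :
  (size p <= n.+1)%N -> (size q <= m.+1)%N -> (size (p * q)%R <= (n + m).+1)%N.
Proof.
move=> hp hq; apply: leq_trans (size_polyMleq _ _) _.
by have := leq_add hp hq; rewrite addSn addnS; case: (_ + size q)%N.
Qed.

Section Homogenization.
Variable K : fieldType.
Implicit Types (p q a b c d : {poly K}) (n m k : nat).
Local Notation x := ('X_0 : {mpoly K[3]}).
Local Notation y := ('X_1 : {mpoly K[3]}).
Local Notation z := ('X_ord_max : {mpoly K[3]}).

(** The degree [n] is chosen independently of [p]: a surplus becomes a power of z, which lets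
    several polynomials share one degree. Coefficients beyond [n] are dropped, whence the size
    hypotheses that follow. *)
Definition homogenize n p : {mpoly K[3]} :=
  \sum_(i < n.+1) p`_i *: (y ^+ i * z ^+ (n - i)).

Lemma dhomogXi (i : 'I_3) : ('X_i : {mpoly K[3]}) \is 1.-homog.
Proof. by rewrite dhomogX /= mdeg1. Qed.

Lemma homogenize_homog n p : homogenize n p \is n.-homog.
Proof.
apply: rpred_sum => i _; apply: rpredZ.
have := dhomogM (dhomogMn i (dhomogXi 1)) (dhomogMn (n - i) (dhomogXi ord_max)).
by rewrite !mul1n subnKC // -ltnS ltn_ord.
Qed.

Lemma homogenizeD n p q : homogenize n (p + q) = homogenize n p + homogenize n q.
Proof. by rewrite -big_split; apply: eq_bigr => i _; rewrite coefD scalerDl. Qed.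

Lemma homogenize0 n : homogenize n 0 = 0.
Proof. by apply: big1 => i _; rewrite coef0 scale0r. Qed.

Lemma comp_homogenize n p (Q : 3.-tuple {mpoly K[3]}) w :
  tnth Q 1 = y * w -> tnth Q ord_max = z * w ->
  homogenize n p \mPo Q = homogenize n p * w ^+ n.
Proof.
move=> e1 e2; rewrite rmorph_sum mulr_suml; apply: eq_bigr => i _ /=.
rewrite comp_mpolyZ rmorphM !rmorphXn /= !comp_mpolyXU -!tnth_nth e1 e2.
rewrite -scalerAl; congr (_ *: _).
rewrite -[in w ^+ n](subnKC (_ : i <= n)%N) -1?ltnS ?ltn_ord // exprD.
by rewrite !exprMn mulrACA.
Qed.

Lemma dehom_homogenize (L : comNzRingType) (iota : {rmorphism {poly K} -> L}) X n p :
  (size p <= n.+1)%N -> dehom iota X (homogenize n p) = iota p.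
Proof.
move=> hp; rewrite rmorph_sum -[in RHS](coefK p) poly_def rmorph_sum /=.
rewrite (big_ord_widen _ (fun i => iota (p`_i *: 'X^i)) hp) [RHS]big_mkcond /=.
apply: eq_bigr => i _; rewrite dehomZ rmorphM !rmorphXn /= dehomX1 dehomX2.
rewrite expr1n mulr1 -mul_polyC rmorphM rmorphXn.
by case: ltnP => // hi; rewrite nth_default // rmorph0 mul0r.
Qed.

Lemma polyC_transc (q : {poly {poly K}}) :
  (map_poly (polyC : {rmorphism {poly K} -> {poly {poly K}}}) q).['X] = 0 -> q = 0.
Proof. by rewrite -[_.[_]]/(q \Po 'X) comp_polyXr. Qed.

Lemma homogenizeM n m p q : (size p <= n.+1)%N -> (size q <= m.+1)%N ->
  homogenize n p * homogenize m q = homogenize (n + m) (p * q).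
Proof.
move=> hp hq; apply: (dehom_inj_eq polyC_transc (d := (n + m)%N)).
- exact: dhomogM (homogenize_homog _ _) (homogenize_homog _ _).
- exact: homogenize_homog.
rewrite rmorphM /= !dehom_homogenize ?rmorphM //.
exact: size_mul_bound.
Qed.

Lemma homogenize1 n : homogenize n 1 = z ^+ n.
Proof.
apply: (dehom_inj_eq polyC_transc (d := n)); first exact: homogenize_homog.
  by have := dhomogMn n (dhomogXi ord_max); rewrite mul1n.
rewrite dehom_homogenize ?size_poly1 //.
by rewrite rmorphXn /= dehomX2 expr1n rmorph1.
Qed.

Lemma homogenize_neq0 n p : (size p <= n.+1)%N -> p != 0 -> homogenize n p != 0.
Proof.
move=> hp; apply: contra => /eqP h.
have := dehom_homogenize (polyC : {rmorphism {poly K} -> {poly {poly K}}}) 'X hp.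
by rewrite h rmorph0 => /esym/eqP; rewrite polyC_eq0.
Qed.

Definition lform n a b := homogenize n a * x + homogenize n b * z.

Lemma lform_homog n a b : lform n a b \is n.+1.-homog.
Proof.
by apply: rpredD; rewrite -(addn1 n); apply: dhomogM; rewrite ?homogenize_homog ?dhomogXi.
Qed.

Lemma dehom_lform (L : comNzRingType) (iota : {rmorphism {poly K} -> L}) X n a b :
  (size a <= n.+1)%N -> (size b <= n.+1)%N ->
  dehom iota X (lform n a b) = iota a * X + iota b.
Proof.
move=> ha hb; rewrite rmorphD !rmorphM /= dehomX0 dehomX2 mulr1.
by rewrite !dehom_homogenize.
Qed.

Lemma lform_eq0 n a b : (size a <= n.+1)%N -> (size b <= n.+1)%N ->
  lform n a b = 0 -> a = 0 /\ b = 0.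
Proof.
move=> ha hb h.
have := dehom_lform (polyC : {rmorphism {poly K} -> {poly {poly K}}}) 'X ha hb.
rewrite h rmorph0 => /esym e; split.
  by have := f_equal (fun p : {poly {poly K}} => p`_1) e; rewrite coefD coefMX !coefC /= addr0.
by have := f_equal (fun p : {poly {poly K}} => p`_0) e; rewrite coefD coefMX !coefC /= add0r.
Qed.

(* The map (x, y) |-> ((a x + b) / (c x + d), y). *)
Definition moebius n a b c d : triple K :=
  [tuple z * lform n a b; y * lform n c d; z * lform n c d].

Lemma moebius0 n a b c d : tnth (moebius n a b c d) 0 = z * lform n a b.
Proof. by []. Qed.

Lemma moebius1 n a b c d : tnth (moebius n a b c d) 1 = y * lform n c d.
Proof. by []. Qed.

Lemma moebius2 n a b c d : tnth (moebius n a b c d) ord_max = z * lform n c d.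
Proof. by []. Qed.

Lemma moebius_homog n a b c d : homog_triple n.+2 (moebius n a b c d).
Proof.
by apply: ord3_ind; rewrite ?moebius0 ?moebius1 ?moebius2 -(add1n n.+1);
  apply: dhomogM; rewrite ?dhomogXi ?lform_homog.
Qed.

(** The last two coordinates of the inner map are y and z times one form, so the coefficients only
    pick up powers of that form, and what remains is a row times a matrix. *)
Lemma comp_lform n k a b a' b' c' d' :
  (size a <= n.+1)%N -> (size b <= n.+1)%N ->
  (size a' <= k.+1)%N -> (size b' <= k.+1)%N ->
  (size c' <= k.+1)%N -> (size d' <= k.+1)%N ->
  lform n a b \mPo moebius k a' b' c' d' =
    z * lform k c' d' ^+ n * lform (n + k) (a * a' + b * c') (a * b' + b * d').
Proof.
move=> ha hb ha' hb' hc' hd'; rewrite rmorphD !rmorphM /=.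
rewrite !(@comp_homogenize _ _ _ (lform k c' d')) //.
rewrite !comp_mpolyXU -!tnth_nth moebius0 moebius2.
rewrite /lform !homogenizeD -!homogenizeM //.
by ring.
Qed.

Lemma comp_moebius n k a b c d a' b' c' d' i :
  (size a <= n.+1)%N -> (size b <= n.+1)%N ->
  (size c <= n.+1)%N -> (size d <= n.+1)%N ->
  (size a' <= k.+1)%N -> (size b' <= k.+1)%N ->
  (size c' <= k.+1)%N -> (size d' <= k.+1)%N ->
  tnth (comp_map (moebius n a b c d) (moebius k a' b' c' d')) i =
    z * lform k c' d' ^+ n.+1 *
    tnth (moebius (n + k) (a * a' + b * c') (a * b' + b * d')
                          (c * a' + d * c') (c * b' + d * d')) i.
Proof.
move=> ha hb hc hd ha' hb' hc' hd'; rewrite tnth_comp_map.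
elim/ord3_ind: i; rewrite ?moebius0 ?moebius1 ?moebius2 rmorphM /= comp_lform //;
  rewrite comp_mpolyXU -tnth_nth ?moebius1 ?moebius2 exprS; ring.
Qed.

End Homogenization.

Lemma size_mulD_bound (A : nzSemiRingType) n k (u u' v v' : {poly A}) :
  (size u <= n.+1)%N -> (size u' <= k.+1)%N ->
  (size v <= n.+1)%N -> (size v' <= k.+1)%N ->
  (size (u * u' + v * v')%R <= (n + k).+1)%N.
Proof.
move=> h1 h2 h3 h4; apply: leq_trans (size_polyD _ _) _.
by rewrite geq_max !size_mul_bound.
Qed.

Section AffineForm.
Variables (K L : fieldType) (iota : {rmorphism {poly K} -> L}) (X : L).
Hypothesis X_transc : forall q : {poly {poly K}}, (map_poly iota q).[X] = 0 -> q = 0.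
Implicit Types (P Q : triple K) (u v : L) (a b c d : {poly K}).

Definition affine_form P u v : Prop :=
  let p i := dehom iota X (tnth P i) in
  [/\ p ord_max != 0, u = p 0 / p ord_max & v = p 1 / p ord_max].

(** The cross products of the two triples are forms of one degree that agree at z = 1, hence are
    equal. *)
Lemma affine_form_same P Q u v : rational_map P -> rational_map Q ->
  affine_form P u v -> affine_form Q u v -> same_map P Q.
Proof.
move=> hP hQ [p2 pu pv] [q2 qu qv].
have [[[d hd] _] [[e he] _]] := (hP, hQ).
split=> // i j; apply: (dehom_inj_eq X_transc (d := (d + e)%N)).
- exact: dhomogM.
- exact: dhomogM.
pose w := tnth [tuple u; v; 1].
have hp k : dehom iota X (tnth P k) = w k * dehom iota X (tnth P ord_max).
  elim/ord3_ind: k; rewrite /w.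
  - by rewrite (_ : tnth [tuple u; v; 1] 0 = u) // pu divfK.
  - by rewrite (_ : tnth [tuple u; v; 1] 1 = v) // pv divfK.
  - by rewrite (_ : tnth [tuple u; v; 1] ord_max = 1) ?mul1r.
have hq k : dehom iota X (tnth Q k) = w k * dehom iota X (tnth Q ord_max).
  elim/ord3_ind: k; rewrite /w.
  - by rewrite (_ : tnth [tuple u; v; 1] 0 = u) // qu divfK.
  - by rewrite (_ : tnth [tuple u; v; 1] 1 = v) // qv divfK.
  - by rewrite (_ : tnth [tuple u; v; 1] ord_max = 1) ?mul1r.
rewrite !rmorphM /= [in LHS]hp [in LHS]hq [in RHS]hp [in RHS]hq.
by ring.
Qed.

Lemma affine_form_moebius n a b c d :
  (size a <= n.+1)%N -> (size b <= n.+1)%N ->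
  (size c <= n.+1)%N -> (size d <= n.+1)%N -> ~ (c = 0 /\ d = 0) ->
  affine_form (moebius n a b c d)
    ((iota a * X + iota b) / (iota c * X + iota d)) (iota 'X).
Proof.
move=> ha hb hc hd ncd.
have w0 : iota c * X + iota d != 0.
  apply/eqP => h; apply: ncd.
  have /eqP : c%:P * 'X + d%:P = 0 :> {poly {poly K}}.
    apply: X_transc; rewrite rmorphD rmorphM /= map_polyX !map_polyC /=.
    by rewrite hornerD hornerM hornerX !hornerC.
  move=> /eqP e; split.
    by have := f_equal (fun p : {poly {poly K}} => p`_1) e; rewrite coefD coefMX !coefC /= addr0.
  by have := f_equal (fun p : {poly {poly K}} => p`_0) e; rewrite coefD coefMX !coefC /= add0r.
by split; rewrite ?moebius0 ?moebius1 ?moebius2 !rmorphM /= dehomX2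
  ?dehomX1 !dehom_lform // !mul1r ?mulfK.
Qed.

End AffineForm.

(** * Inverses and diagonalization of fibered Moebius maps *)

Section Conjugation.
Variable K : fieldType.
Implicit Types (a b c d p q r s : {poly K}).

Lemma moebius_rational n a b c d :
  (size c <= n.+1)%N -> (size d <= n.+1)%N -> ~ (c = 0 /\ d = 0) ->
  rational_map (moebius n a b c d).
Proof.
move=> hc hd ncd; split; first by exists n.+2; apply: moebius_homog.
exists ord_max; rewrite moebius2 mulf_neq0 ?mpolyX_neq0 //.
by apply/eqP => /(lform_eq0 hc hd).
Qed.

Lemma same_map_scale (P Q : triple K) t :
  rational_map P -> rational_map Q ->
  (forall i, tnth P i = t * tnth Q i) -> same_map P Q.
Proof. by move=> hP hQ e; split=> // i j; rewrite !e; ring. Qed.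

(** This removes the determinant that an adjugate leaves on the diagonal. The two sides carry
    unrelated degrees, so cross products are compared at z = 1. *)
Lemma moebius_scale n m s a b c d :
  (size (s * a)%R <= n.+1)%N -> (size (s * b)%R <= n.+1)%N ->
  (size (s * c)%R <= n.+1)%N -> (size (s * d)%R <= n.+1)%N ->
  (size a <= m.+1)%N -> (size b <= m.+1)%N ->
  (size c <= m.+1)%N -> (size d <= m.+1)%N ->
  s != 0 -> ~ (c = 0 /\ d = 0) ->
  same_map (moebius n (s * a) (s * b) (s * c) (s * d)) (moebius m a b c d).
Proof.
move=> hsa hsb hsc hsd ha hb hc hd s0 ncd.
have e p q p' q' : (size (s * p)%R <= n.+1)%N -> (size (s * q)%R <= n.+1)%N ->
    (size p <= m.+1)%N -> (size q <= m.+1)%N ->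
    (size (s * p')%R <= n.+1)%N -> (size (s * q')%R <= n.+1)%N ->
    (size p' <= m.+1)%N -> (size q' <= m.+1)%N ->
    lform n (s * p) (s * q) * lform m p' q' = lform n (s * p') (s * q') * lform m p q.
  move=> h1 h2 h3 h4 h5 h6 h7 h8.
  apply: (dehom_inj_eq (@polyC_transc K) (d := (n.+1 + m.+1)%N)).
  - exact: dhomogM (lform_homog _ _ _) (lform_homog _ _ _).
  - exact: dhomogM (lform_homog _ _ _) (lform_homog _ _ _).
  by rewrite 2!rmorphM /= !dehom_lform // !rmorphM; ring.
split; [apply: moebius_rational => //|exact: moebius_rational|].
  move=> [/eqP + /eqP]; rewrite !mulf_eq0 (negbTE s0) /= => /eqP c0 /eqP d0.
  exact: ncd.
have {}e := e a b c d hsa hsb ha hb hsc hsd hc hd.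
by apply: ord3_ind; apply: ord3_ind; rewrite ?moebius0 ?moebius1 ?moebius2;
  move: e; set u := lform n _ _; set v := lform n _ _;
  set u' := lform m _ _; set v' := lform m _ _ => e; ring: e.
Qed.

(** The inverse is given by the adjugate, which keeps the entries polynomial; the determinant
    becomes a common factor of the composed triple. *)
Lemma inverse_moebius k p q r s :
  (size p <= k.+1)%N -> (size q <= k.+1)%N ->
  (size r <= k.+1)%N -> (size s <= k.+1)%N -> p * s - q * r != 0 ->
  inverse_maps (moebius k s (- q) (- r) p) (moebius k p q r s).
Proof.
move=> hp hq hr hs det0.
have n1 : ~ (r = 0 /\ s = 0).
  by case=> r0 s0; rewrite r0 s0 !mulr0 subrr eqxx in det0.
have n2 : ~ (- r = 0 /\ p = 0).
  by case=> /eqP; rewrite oppr_eq0 => /eqP r0 p0; rewrite r0 p0 mulr0 mul0r subrr eqxx in det0.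
have hq' : (size (- q)%R <= k.+1)%N by rewrite size_polyN.
have hr' : (size (- r)%R <= k.+1)%N by rewrite size_polyN.
have hid : rational_map (id_map K).
  split; first by exists 1%N => i; rewrite tnth_id_map dhomogXi.
  by exists 0; rewrite tnth_id_map mpolyX_neq0.
have key p' q' r' s' : (size p' <= k.+1)%N -> (size q' <= k.+1)%N ->
    (size r' <= k.+1)%N -> (size s' <= k.+1)%N -> p' * s' - q' * r' != 0 ->
    ~ (r' = 0 /\ s' = 0) ->
    same_map (comp_map (moebius k s' (- q') (- r') p') (moebius k p' q' r' s')) (id_map K).
  move=> hp' hq1 hr1 hs' det' nrs; set D : {poly K} := p' * s' - q' * r' in det'.
  have sN (u : {poly K}) : (size u <= k.+1)%N -> (size (- u)%R <= k.+1)%N by rewrite size_polyN.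
  have hD : (size D <= (k + k).+1)%N.
    by rewrite /D -mulNr; apply: size_mulD_bound; rewrite ?sN.
  have E i : tnth (comp_map (moebius k s' (- q') (- r') p') (moebius k p' q' r' s')) i =
     ('X_ord_max : {mpoly K[3]}) * lform k r' s' ^+ k.+1 * (('X_ord_max : {mpoly K[3]}) * homogenize (k + k) D) * tnth (id_map K) i.
    rewrite comp_moebius ?sN // -[RHS]mulrA; congr (_ * _).
    have -> : s' * p' + - q' * r' = D by rewrite /D; ring.
    have -> : s' * q' + - q' * s' = 0 by ring.
    have -> : - r' * p' + p' * r' = 0 by ring.
    have -> : - r' * q' + p' * s' = D by rewrite /D; ring.
    rewrite tnth_id_map; elim/ord3_ind: i;
      rewrite ?moebius0 ?moebius1 ?moebius2 /lform homogenize0; ring.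
  apply: (same_map_scale _ hid E).
  split; first by exists (k.+2 * k.+2)%N; apply: homog_comp_map; apply: moebius_homog.
  exists 0; rewrite E tnth_id_map !mulf_neq0 ?mpolyX_neq0 ?expf_neq0 ?homogenize_neq0 //.
  by apply/eqP => /(lform_eq0 hr1 hs').
split; [exact: moebius_rational|exact: moebius_rational|exact: key|].
(* The other composition is the same statement for the adjugate, whose adjugate is the original
   matrix. *)
have := key s (- q) (- r) p hs hq' hr' hp.
rewrite !opprK; apply=> //.
by move: det0; rewrite mulrC mulrNN.
Qed.

(** The columns of P = (p q; r s) are eigenvectors, so M P = P diag(r1, r2) and adj(P) M P = det(P)
    diag(r1, r2). *)
Lemma conjugate_moebius_diag n m (A B C D p q r s r1 r2 : {poly K}) (f : triple K) :
  (size A <= n.+1)%N -> (size B <= n.+1)%N ->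
  (size C <= n.+1)%N -> (size D <= n.+1)%N ->
  (size r1 <= m.+1)%N -> (size r2 <= m.+1)%N ->
  same_map f (moebius n A B C D) ->
  A * p + B * r = r1 * p -> A * q + B * s = r2 * q ->
  C * p + D * r = r1 * r -> C * q + D * s = r2 * s ->
  p * s - q * r != 0 -> r1 != 0 -> r2 != 0 ->
  conjugate f (moebius m r1 0 0 r2).
Proof.
move=> hA hB hC hD hr1 hr2 hf e11 e12 e21 e22 det0 r10 r20.
pose k := (size p + size q + size r + size s)%N.
have hp : (size p <= k.+1)%N by rewrite /k; lia.
have hq : (size q <= k.+1)%N by rewrite /k; lia.
have hr : (size r <= k.+1)%N by rewrite /k; lia.
have hs : (size s <= k.+1)%N by rewrite /k; lia.
have hinv := inverse_moebius hp hq hr hs det0.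
set h := moebius k s _ _ _ in hinv; set h' := moebius k p _ _ _ in hinv.
exists h, h'; split=> //.
have [hh hh' _ _] := hinv; have [hfr hM _] := hf.
have bh' : birational h' by exists h; apply: inverse_maps_sym.
have hfh' := rational_comp_birational hfr bh'.
have nMP : ~ (r1 * r = 0 /\ r2 * s = 0).
  move=> [/eqP + /eqP]; rewrite !mulf_eq0 (negbTE r10) (negbTE r20) /=.
  by move=> /eqP r0 /eqP s0; rewrite r0 s0 !mulr0 subrr eqxx in det0.
have h11 : (size (r1 * p)%R <= (n + k).+1)%N by rewrite -e11; apply: size_mulD_bound.
have h12 : (size (r2 * q)%R <= (n + k).+1)%N by rewrite -e12; apply: size_mulD_bound.
have h21 : (size (r1 * r)%R <= (n + k).+1)%N by rewrite -e21; apply: size_mulD_bound.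
have h22 : (size (r2 * s)%R <= (n + k).+1)%N by rewrite -e22; apply: size_mulD_bound.
(* [S] carries the matrix M P in the form P diag(r1, r2). *)
pose S := moebius (n + k) (r1 * p) (r2 * q) (r1 * r) (r2 * s).
have hS : rational_map S by apply: moebius_rational.
have fS : same_map (comp_map f h') S.
  have hMh' := rational_comp_birational hM bh'.
  apply: same_map_trans (same_map_compl hfh' hMh' hf) _.
  apply: (same_map_scale (t := 'X_ord_max * lform k r s ^+ n.+1) hMh' hS) => i.
  by rewrite /h' comp_moebius // e11 e12 e21 e22.
have hq' : (size (- q)%R <= k.+1)%N by rewrite size_polyN.
have hr' : (size (- r)%R <= k.+1)%N by rewrite size_polyN.
set d := p * s - q * r in det0.
have d11 : s * (r1 * p) + - q * (r1 * r) = d * r1 by rewrite /d; ring.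
have d12 : s * (r2 * q) + - q * (r2 * s) = d * 0 by ring.
have d21 : - r * (r1 * p) + p * (r1 * r) = d * 0 by ring.
have d22 : - r * (r2 * q) + p * (r2 * s) = d * r2 by rewrite /d; ring.
have E i : tnth (comp_map h S) i =
    'X_ord_max * lform (n + k) (r1 * r) (r2 * s) ^+ k.+1 *
    tnth (moebius (k + (n + k)) (d * r1) (d * 0) (d * 0) (d * r2)) i.
  by rewrite comp_moebius // d11 d12 d21 d22.
have hdr : (size (d * r1)%R <= (k + (n + k)).+1)%N.
  by rewrite -d11; apply: size_mulD_bound.
have hdr2 : (size (d * r2)%R <= (k + (n + k)).+1)%N.
  by rewrite -d22; apply: size_mulD_bound.
have nr2 : ~ (0 = 0 :> {poly K} /\ r2 = 0) by case=> _ /eqP; apply/negP.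
have hD0 : rational_map (moebius (k + (n + k)) (d * r1) (d * 0) (d * 0) (d * r2)).
  apply: moebius_rational; rewrite ?mulr0 ?size_poly0 // => -[_ /eqP].
  by rewrite mulf_eq0 (negbTE det0) (negbTE r20).
have hhS : rational_map (comp_map h S).
  split; first by exists ((n + k).+2 * k.+2)%N; apply: homog_comp_map; apply: moebius_homog.
  have [_ [i hi]] := hD0; exists i; rewrite E mulf_neq0 // mulf_neq0 ?mpolyX_neq0 //.
  by rewrite expf_neq0 //; apply/eqP => /(lform_eq0 h21 h22).
apply: same_map_trans (same_map_compr hhS hh (same_map_sym fS)).
apply: same_map_sym; apply: (same_map_trans (same_map_scale hhS hD0 E)).
by apply: moebius_scale; rewrite ?mulr0 ?size_poly0.
Qed.

End Conjugation.

(** * Degrees *)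

Section DegreeDiagonal.
Variable K : fieldType.
Implicit Types (p q r : {poly K}).
Local Notation x := ('X_0 : {mpoly K[3]}).
Local Notation y := ('X_1 : {mpoly K[3]}).
Local Notation z := ('X_ord_max : {mpoly K[3]}).

Lemma homogenize_subst0 n p : homogenize n p \mPo subst_var 0 0 = homogenize n p.
Proof.
rewrite (@comp_homogenize _ _ _ _ 1) ?expr1n ?mulr1 //; first by rewrite tnth_mktuple.
by rewrite tnth_mktuple.
Qed.

Lemma homogenize_subst2 n p :
  homogenize n p \mPo subst_var ord_max 0 = p`_n *: y ^+ n.
Proof.
rewrite /homogenize big_ord_recr rmorphD /= subnn mulr1 rmorph_sum big1 /=.
  by rewrite add0r comp_mpolyZ rmorphXn /= comp_subst_var.
move=> i _; rewrite comp_mpolyZ rmorphM !rmorphXn /= !comp_subst_var eqxx.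
by rewrite mpolyC0 expr0n subn_eq0 leqNgt ltn_ord mulr0 scaler0.
Qed.

Lemma homogenize_subst2_neq0 n p :
  size p = n.+1 -> homogenize n p \mPo subst_var ord_max 0 != 0.
Proof.
move=> hs; rewrite homogenize_subst2 scaler_eq0 expf_eq0 (negbTE (mpolyX_neq0 _ _)).
by rewrite andbF orbF -[n]/(n.+1.-1) -hs -lead_coefE lead_coef_eq0 -size_poly_eq0 hs.
Qed.

(* A Bezout relation in [K[y]], homogenized, reads [a P + b Q = z ^ N]. *)
Lemma coprime_forms_factor m p q (v w : {mpoly K[3]}) :
  coprimep p q -> (size p <= m.+1)%N -> (size q <= m.+1)%N ->
  size p = m.+1 \/ size q = m.+1 -> p != 0 -> q != 0 ->
  homogenize m p * w = homogenize m q * v ->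
  exists t, v = homogenize m p * t /\ w = homogenize m q * t.
Proof.
move=> /Bezout_eq1_coprimepP[[a b] /= hab] hp hq hpq p0 q0 e.
pose k := (size a + size b)%N.
have ha : (size a <= k.+1)%N by rewrite /k; lia.
have hb : (size b <= k.+1)%N by rewrite /k; lia.
have hz : homogenize k a * homogenize m p + homogenize k b * homogenize m q
          = z ^+ (k + m).
  by rewrite !homogenizeM // -homogenizeD hab homogenize1.
have P0 := homogenize_neq0 hp p0; have Q0 := homogenize_neq0 hq q0.
move: (homogenize_subst2_neq0 (n := m) (p := p)) (homogenize_subst2_neq0 (n := m) (p := q)).
move: (homogenize m p) (homogenize m q) P0 Q0 e hz => P Q P0 Q0 e.
move: (homogenize k a) (homogenize k b) => a' b' hz hP hQ.
(* One of the two forms has full degree [m] in y, so z does not divide it and the power of z in the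
   Bezout relation can be cancelled. *)
case: hpq => [/hP{hP hQ} hP|/hQ{hP hQ} hQ].
  have e1 : z ^+ (k + m) * v = P * (a' * v + b' * w).
    by rewrite -hz; ring: e.
  have [t et] := varX_prime e1 hP; exists t.
  have ev : v = P * t.
    apply: (mulfI (expf_neq0 (k + m) (mpolyX_neq0 K U_(ord_max)%MM))).
    by rewrite e1 et; ring.
  by split=> //; apply: (mulfI P0); rewrite e ev; ring.
have e1 : z ^+ (k + m) * w = Q * (a' * v + b' * w).
  by rewrite -hz; ring: e.
have [t et] := varX_prime e1 hQ; exists t.
have ew : w = Q * t.
  apply: (mulfI (expf_neq0 (k + m) (mpolyX_neq0 K U_(ord_max)%MM))).
  by rewrite e1 et; ring.
by split=> //; apply: (mulfI Q0); rewrite -e ew; ring.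
Qed.

(** The reduced triple is computed: primality of the variables and coprimality of [p'], [q'] force
    [G] to be a constant times (x P', y Q', z Q'), with P', Q' the homogenized [p'], [q']. *)
Lemma degree_moebius_diag n d e r1 r2 rho p q (G : triple K) :
  (size r1 <= n.+1)%N -> (size r2 <= n.+1)%N -> r1 != 0 -> r2 != 0 ->
  same_map (moebius n r1 0 0 r2) G -> homog_triple e G -> no_common_factor G ->
  r1 = rho * p -> r2 = rho * q -> (size p <= d)%N -> (size q <= d)%N ->
  (e <= d)%N.
Proof.
move=> hr1 hr2 r10 r20 hG he nG e1 e2 hpd hqd.
pose g := gcdp r1 r2; pose p' := r1 %/ g; pose q' := r2 %/ g.
have e1' : r1 = p' * g by rewrite divpK // dvdp_gcdl.
have e2' : r2 = q' * g by rewrite divpK // dvdp_gcdr.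
have g0 : g != 0 by rewrite gcdp_eq0 (negbTE r10).
have cpq : coprimep p' q' by rewrite coprimep_div_gcd // r10.
have p'0 : p' != 0 by apply: contra r10 => /eqP h; rewrite e1' h mul0r.
have q'0 : q' != 0 by apply: contra r20 => /eqP h; rewrite e2' h mul0r.
have p0 : p != 0 by apply: contra r10 => /eqP h; rewrite e1 h mulr0.
have q0 : q != 0 by apply: contra r20 => /eqP h; rewrite e2 h mulr0.
have rho0 : rho != 0 by apply: contra r10 => /eqP h; rewrite e1 h mul0r.
(* [p] and [q] need not be coprime; since [rho] divides the gcd [g], the coprime quotients [p'],
   [q'] are no larger. *)
have rhog : (size rho <= size g)%N.
  by apply: dvdp_leq => //; rewrite dvdp_gcd e1 e2 !dvdp_mulr.
have sp : (0 < size p)%N by rewrite lt0n size_poly_eq0.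
have sq : (0 < size q)%N by rewrite lt0n size_poly_eq0.
have sp' : (0 < size p')%N by rewrite lt0n size_poly_eq0.
have sq' : (0 < size q')%N by rewrite lt0n size_poly_eq0.
have sg : (0 < size g)%N by rewrite lt0n size_poly_eq0.
have srho : (0 < size rho)%N by rewrite lt0n size_poly_eq0.
have s1 : size r1 = (size rho + size p).-1 by rewrite e1 size_mul.
have s2 : size r2 = (size rho + size q).-1 by rewrite e2 size_mul.
have s1' : size r1 = (size p' + size g).-1 by rewrite {1}e1' size_mul.
have s2' : size r2 = (size q' + size g).-1 by rewrite {1}e2' size_mul.
(* The exact maximum of the two degrees, because [coprime_forms_factor] wants one of the forms to
   have full degree. *)
pose m := (maxn (size p') (size q')).-1.
have md : (m < d)%N by rewrite /m; lia.
have hp' : (size p' <= m.+1)%N by rewrite /m; lia.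
have hq' : (size q' <= m.+1)%N by rewrite /m; lia.
have hpq : size p' = m.+1 \/ size q' = m.+1 by rewrite /m; lia.
have mn : (m <= n)%N by rewrite /m; lia.
have gk : (size g <= (n - m).+1)%N by rewrite /m; lia.
have E1 : homogenize n r1 = homogenize m p' * homogenize (n - m) g.
  by rewrite homogenizeM // subnKC // -e1'.
have E2 : homogenize n r2 = homogenize m q' * homogenize (n - m) g.
  by rewrite homogenizeM // subnKC // -e2'.
have [_ [_ [k Gk]] eG] := hG.
have W0 := homogenize_neq0 gk g0; have P0 := homogenize_neq0 hp' p'0.
have Q0 := homogenize_neq0 hq' q'0.
have z0 : z != 0 by apply: mpolyX_neq0.
have x0 : x != 0 by apply: mpolyX_neq0.
have y0 : y != 0 by apply: mpolyX_neq0.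
have R12 : y * tnth G ord_max = z * tnth G 1.
  have := eG 1 ord_max; rewrite moebius1 moebius2 /lform homogenize0 E2 => h.
  apply: (mulfI (mulf_neq0 (mulf_neq0 Q0 W0) z0)).
  by rewrite mul0r add0r in h; ring: h.
have [w Gw] : exists w, tnth G 1 = y * w.
  by apply: var_prime R12 _; rewrite comp_subst_var; apply: mpolyX_neq0.
have Gw2 : tnth G ord_max = z * w.
  by apply: (mulfI y0); rewrite R12 Gw; ring.
have R02 : x * (homogenize m p' * w) = homogenize m q' * tnth G 0.
  have := eG 0 ord_max; rewrite moebius0 moebius2 /lform homogenize0 E1 E2 Gw2 => h.
  apply: (mulfI (mulf_neq0 (mulf_neq0 z0 W0) z0)).
  by rewrite !mul0r add0r addr0 in h; ring: h.
have [v Gv] : exists v, tnth G 0 = x * v.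
  by apply: var_prime R02 _; rewrite homogenize_subst0.
have [|t [ev ew]] := coprime_forms_factor cpq hp' hq' hpq p'0 q'0 (v := v) (w := w).
  by apply: (mulfI x0); rewrite R02 Gv; ring.
(* [t] divides all three coordinates of the reduced triple, so it is a constant and the degree of
   [G] can be read off. *)
have /andP[/eqP et ut] : t \is a GRing.unit.
  apply: nG; apply: ord3_ind; rewrite ?Gv ?Gw ?Gw2 ?ev ?ew.
  - by exists (x * homogenize m p'); rewrite mulrA.
  - by exists (y * homogenize m q'); rewrite mulrA.
  - by exists (z * homogenize m q'); rewrite mulrA.
have G2 : tnth G ord_max \is (1 + m).-homog.
  rewrite Gw2 ew et mulrC mulrC; apply: dhomogM; first exact: dhomogXi.
  by rewrite mulrC mul_mpolyC; apply: rpredZ; apply: homogenize_homog.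
have G2n0 : tnth G ord_max != 0.
  apply: same_map_neq0 hG _; rewrite moebius2 mulf_neq0 // /lform homogenize0 mul0r add0r.
  by rewrite mulf_neq0 // E2 mulf_neq0.
by rewrite (dhomog_uniq G2n0 (he _) G2) add1n.
Qed.

End DegreeDiagonal.

(** * K[y] inside K[x, y, z], and total degrees at z = 1 *)

Section EmbedY.
Variable K : fieldType.
Implicit Types (p q a b : {poly K}).
Local Notation x := ('X_0 : {mpoly K[3]}).
Local Notation y := ('X_1 : {mpoly K[3]}).

(** With this embedding, setting z = 1 stays inside [{mpoly K[3]}], where [msize] measures the total
    degree and [subst_var] tests divisibility by y - al. *)
Definition poly_y : {poly K} -> {mpoly K[3]} := horner_alg y.

HB.instance Definition _ := GRing.RMorphism.copy poly_y (horner_alg y).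

Lemma poly_yC c : poly_y c%:P = c%:MP.
Proof. by rewrite /poly_y horner_algC -mul_mpolyC mulr1. Qed.

Lemma poly_yX : poly_y 'X = y.
Proof. exact: horner_algX. Qed.

Lemma dehom_C (L : comNzRingType) (iota : {rmorphism {poly K} -> L}) X c :
  dehom iota X c%:MP = iota c%:P.
Proof. exact: mmapC. Qed.

Lemma dehom_poly_y (L : comNzRingType) (iota : {rmorphism {poly K} -> L}) X p :
  dehom iota X (poly_y p) = iota p.
Proof.
elim/poly_ind: p => [|p c IH]; first by rewrite !rmorph0.
by rewrite !rmorphD !rmorphM /= poly_yC poly_yX IH dehomX1 dehom_C.
Qed.

Lemma poly_y_inj : injective poly_y.
Proof.
move=> p q e; pose id_y : {rmorphism {poly K} -> {poly K}} := idfun.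
by have := dehom_poly_y id_y 0 p; rewrite e dehom_poly_y.
Qed.

Lemma poly_y_neq0 p : p != 0 -> poly_y p != 0.
Proof.
move=> p0; apply/negP => /eqP h; case/eqP: p0; apply: poly_y_inj.
by rewrite h rmorph0.
Qed.

Lemma poly_y_transc (q : {poly {poly K}}) : (map_poly poly_y q).[x] = 0 -> q = 0.
Proof.
pose C_y : {rmorphism {poly K} -> {poly {poly K}}} := polyC.
move=> h; have : dehom C_y 'X (map_poly poly_y q).[x] = 0 by rewrite h rmorph0.
rewrite -horner_map /= dehomX0 -map_poly_comp (eq_map_poly (g := C_y)).
  exact: polyC_transc.
by move=> p /=; rewrite dehom_poly_y.
Qed.

Lemma msize_dehom_y d (p : {mpoly K[3]}) :
  p \is d.-homog -> (msize (dehom poly_y x p) <= d.+1)%N.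
Proof.
move=> /dhomogP hp; rewrite /dehom /mmap big_seq.
apply: leq_trans (mmeasure_sum _ _ _ _) _; apply/bigmax_leqP_seq => m hm _ /=.
rewrite poly_yC mul_mpolyC; apply: leq_trans (msizeZ_le _ _) _.
rewrite /mmap1 !big_ord_recl big_ord0 mulr1.
rewrite [tnth _ (lift _ (lift _ _))](_ : _ = 1) // expr1n mulr1.
rewrite [tnth _ ord0](_ : _ = x) // [tnth _ (lift _ _)](_ : _ = y); last exact: poly_yX.
rewrite !mpolyXn -mpolyXD msizeX ltnS mdegD !mdegMn !mdeg1 !mul1n.
by rewrite -(hp _ hm) /= mdegE !big_ord_recl addnA leq_addr.
Qed.

Lemma poly_y_root_subst al (p : {poly K}) : root p al -> poly_y p \mPo subst_var 1 al = 0.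
Proof.
move=> /factor_theorem[q ->]; rewrite rmorphM rmorphB /= poly_yC poly_yX rmorphM /=.
by rewrite subst_varXB mulr0.
Qed.

Lemma mcoeff_poly_y p (m : 'X_{1..3}) :
  (poly_y p)@_m = if m == (U_(1) *+ m 1)%MM then p`_(m 1) else 0.
Proof.
have -> : poly_y p = \sum_(i < size p) p`_i *: 'X_[(U_(1) *+ i)%MM].
  rewrite -{1}(coefK p) poly_def rmorph_sum /=; apply: eq_bigr => i _.
  by rewrite -mul_polyC rmorphM rmorphXn /= poly_yC poly_yX mul_mpolyC mpolyXn.
rewrite raddf_sum /=; case: eqP => [e|ne]; last first.
  rewrite big1 // => i _; rewrite mcoeffZ mcoeffX; case: eqP => [e|]; last by rewrite mulr0.
  by case: ne; rewrite -e mulmnE mnm1E eqxx mul1n.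
have E (i : nat) : ((U_(1) *+ i)%MM == m) = (i == m 1).
  rewrite {1}e; apply/eqP/eqP => [/mnmP/(_ 1)|-> //].
  by rewrite !mulmnE mnm1E eqxx !mul1n.
have [hm|hm] := ltnP (m 1) (size p).
  rewrite (bigD1 (Ordinal hm)) //= mcoeffZ mcoeffX E eqxx mulr1 big1 ?addr0 // => i.
  by rewrite mcoeffZ mcoeffX E -val_eqE /= => /negbTE ->; rewrite mulr0.
rewrite nth_default // big1 // => i _; rewrite mcoeffZ mcoeffX E.
by rewrite ltn_eqF ?mulr0 // (leq_trans (ltn_ord i)).
Qed.

(** The monomials of the two summands are disjoint, so nothing cancels; the factor x costs [a] one
    degree. *)
Lemma msize_linear_bound k a b : (msize (poly_y a * x + poly_y b) <= k)%N ->
  (size a <= k.-1)%N /\ (size b <= k)%N.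
Proof.
move=> hk; have m01 : (0 == 1 :> 'I_3) = false by [].
split; apply/leq_sizeP => i hi; apply/eqP; rewrite -[_ == 0]negbK; apply/negP => ci.
  have : (U_(0%R) + U_(1) *+ i)%MM \in msupp (poly_y a * x + poly_y b).
    rewrite mcoeff_msupp mcoeffD mcoeffMX !mcoeff_poly_y.
    rewrite mnmDE !mulmnE !mnm1E eqxx m01 mul1n add0n eqxx.
    rewrite ifN ?addr0 //; apply/eqP => e.
    by have := f_equal (fun m : 'X_{1..3} => m 0%R) e; rewrite mnmDE !mulmnE !mnm1E eqxx.
  move=> /msize_mdeg_lt; rewrite mdegD mdegMn !mdeg1 mul1n => h.
  by move: (leq_trans h hk) hi; case: (k) => // k'; rewrite add1n ltnS /=; case: ltngtP.
have : (U_(1) *+ i)%MM \in msupp (poly_y a * x + poly_y b).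
  rewrite mcoeff_msupp mcoeffD !mcoeff_poly_y !mulmnE !mnm1E eqxx mul1n eqxx.
  rewrite mcoeffM big1 ?add0r // => -[m1 m2] /= /eqP e0.
  have := f_equal (fun m : 'X_{1..3} => m 0%R) e0.
  rewrite /= mnmDE mulmnE mnm1E mul0n => /esym/eqP; rewrite addn_eq0 => /andP[_ m20].
  rewrite mcoeffX; case: eqP => [e|]; last by rewrite mulr0.
  by move: m20; rewrite -e mnm1E.
move=> /msize_mdeg_lt; rewrite mdegMn mdeg1 mul1n => h.
by move: (leq_trans h hk); rewrite ltnNge hi.
Qed.

End EmbedY.

(** Eliminating [v], respectively [u], exhibits the pair as a multiple of the two linear forms up to
    the determinant, which will not involve x. *)
Lemma moebius_resultant (S : comNzRingType) (a b c d x u v : S) :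
  (a * x + b) * u = (c * x + d) * v ->
  (a * d - b * c) * u = (a * u - c * v) * (c * x + d) /\
  (a * d - b * c) * v = (a * u - c * v) * (a * x + b).
Proof.
move=> e; split.
  transitivity (a * u * (c * x + d) - c * ((a * x + b) * u)); first by ring.
  by rewrite e; ring.
transitivity (a * ((c * x + d) * v) - c * v * (a * x + b)); first by ring.
by rewrite -e; ring.
Qed.

(** * Bounds on the matrix entries in terms of the degree of the map *)

Section DegreeLowerBound.
Variable K : closedFieldType.
Implicit Types (p q a b A B C D : {poly K}) (u v s c t : {mpoly K[3]}).
Local Notation x := ('X_0 : {mpoly K[3]}).
Local Notation y := ('X_1 : {mpoly K[3]}).
Local Notation z := ('X_ord_max : {mpoly K[3]}).

(* Gauss' lemma, by removing the roots of [d] one at a time. *)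
Lemma split_content d u v s c c' :
  d != 0 -> poly_y d * u = s * c -> poly_y d * v = s * c' ->
  exists d1 d2 t e e', [/\ d = d1 * d2, s = poly_y d1 * t,
    c = poly_y d2 * e & c' = poly_y d2 * e'].
Proof.
have [n] := ubnP (size d); elim: n d u v s c c' => // n IH d u v s c c' hn d0 e1 e2.
have [/size_poly1P[k k0 dk]|/closed_rootP[al hal]] := boolP (size d == 1)%N.
  exists d, 1, (poly_y k^-1%:P * s), c, c'; split; rewrite ?mulr1 ?rmorph1 ?mul1r //.
  by rewrite mulrA -rmorphM dk -polyCM divff // rmorph1 mul1r.
have /factor_theorem[d' ed] := hal.
have d'0 : d' != 0 by apply: contra d0 => /eqP h; rewrite ed h mul0r.
have hn' : (size d' < n)%N.
  move: hn; rewrite ed size_Mmonic ?monicXsubC // size_XsubC addn2 /= ltnS.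
  exact: leq_trans.
have eyd : poly_y d = poly_y d' * (y - al%:MP).
  by rewrite ed rmorphM rmorphB /= poly_yX poly_yC.
have ya0 : y - al%:MP != 0.
  by move: (poly_y_neq0 d0); rewrite eyd mulf_eq0 negb_or => /andP[].
have edB : poly_y ('X - al%:P) = y - al%:MP by rewrite rmorphB /= poly_yX poly_yC.
have sub0 w w' : poly_y d * w = s * w' ->
    (s \mPo subst_var 1 al == 0) || (w' \mPo subst_var 1 al == 0).
  move=> e; rewrite -mulf_eq0 -rmorphM -e rmorphM /= (poly_y_root_subst hal).
  by rewrite mul0r eqxx.
(* If y - al divides [s], it goes into [d1]. Otherwise it must divide both [c] and [c'], and it goes
   into [d2]; treating the two equations together makes [d2] common to both. *)
have [/eqP/subst_var_dvd[s' es]|sn0] := boolP (s \mPo subst_var 1 al == 0).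
  have [||d1 [d2 [t [e [e' [h1 h2 h3 h4]]]]]] := IH d' u v s' c c' hn' d'0.
  - by apply: (mulfI ya0); rewrite !mulrA -es -e1 eyd; ring.
  - by apply: (mulfI ya0); rewrite !mulrA -es -e2 eyd; ring.
  exists (d1 * ('X - al%:P)), d2, t, e, e'; split; [| |exact: h3|exact: h4].
    by rewrite ed h1; ring.
  by rewrite es h2 rmorphM /= edB; ring.
have [c1 ec] : exists c1, c = (y - al%:MP) * c1.
  by apply: subst_var_dvd; have := sub0 _ _ e1; rewrite (negbTE sn0) => /eqP.
have [c1' ec'] : exists c1', c' = (y - al%:MP) * c1'.
  by apply: subst_var_dvd; have := sub0 _ _ e2; rewrite (negbTE sn0) => /eqP.
have [||d1 [d2 [t [e [e' [h1 h2 h3 h4]]]]]] := IH d' u v s c1 c1' hn' d'0.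
- by apply: (mulfI ya0); rewrite [RHS]mulrCA -ec -e1 eyd; ring.
- by apply: (mulfI ya0); rewrite [RHS]mulrCA -ec' -e2 eyd; ring.
exists d1, (d2 * ('X - al%:P)), t, e, e'; split; [|exact: h2| |].
- by rewrite ed h1; ring.
- by rewrite ec h3 rmorphM /= edB; ring.
by rewrite ec' h4 rmorphM /= edB; ring.
Qed.

(** The cofactor [c] is not known in advance to be linear in x. Its values at x = 0 and x = 1 supply
    the quotients, and cancelling [d] then identifies it. *)
Lemma linear_content d A B c : d != 0 ->
  poly_y A * x + poly_y B = poly_y d * c ->
  exists A' B', [/\ A = d * A', B = d * B' & c = poly_y A' * x + poly_y B'].
Proof.
move=> d0 e; pose id_y : {rmorphism {poly K} -> {poly K}} := idfun.
have ev k : A * k + B = d * dehom id_y k c.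
  have := f_equal (dehom id_y k) e.
  by rewrite rmorphD !rmorphM /= !dehom_poly_y dehomX0.
pose B' := dehom id_y 0 c; pose A' := dehom id_y 1 c - B'.
have eB : B = d * B' by rewrite -ev mulr0 add0r.
have eA : A = d * A' by rewrite mulrBr -ev -eB mulr1 addrK.
exists A', B'; split=> //; apply: (mulfI (poly_y_neq0 d0)).
by rewrite -e mulrDr mulrA -!rmorphM /= -eA -eB.
Qed.

Lemma msize_dvdl t c : t != 0 -> (msize c <= msize (t * c))%N.
Proof.
move=> t0; have [->|c0] := eqVneq c 0; first by rewrite mulr0.
have : (0 < msize t)%N by rewrite lt0n msize_poly_eq0.
by rewrite msizeM //; case: (msize t) => // k _; rewrite addSn /= leq_addl.
Qed.

Lemma msize_mulX_bound i d c : (msize ('X_i * c) <= d.+1)%N -> (msize c <= d)%N.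
Proof.
have [->|c0] := eqVneq c 0; first by rewrite msize0.
by rewrite msizeM ?mpolyX_neq0 // msizeX mdeg1.
Qed.

Lemma degree_moebius_bound n d A B C D (F : triple K) :
  (size A <= n.+1)%N -> (size B <= n.+1)%N ->
  (size C <= n.+1)%N -> (size D <= n.+1)%N -> A * D - B * C != 0 ->
  same_map (moebius n A B C D) F -> homog_triple d F ->
  exists e A' B' C' D',
    [/\ A = e * A', B = e * B', C = e * C' & D = e * D'] /\
    [/\ (size A' <= d)%N, (size B' <= d.+1)%N, (size C' <= d.-1)%N & (size D' <= d)%N].
Proof.
move=> hA hB hC hD det0 hF hd; have [_ _ eF] := hF.
have L0 : lform n C D != 0.
  apply/eqP => /(lform_eq0 hC hD)[C0 D0].
  by rewrite C0 D0 !mulr0 subrr eqxx in det0.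
have z0 : z != 0 by apply: mpolyX_neq0.
have F20 : tnth F ord_max != 0.
  by apply: same_map_neq0 hF _; rewrite moebius2 mulf_neq0.
have R12 : y * tnth F ord_max = z * tnth F 1.
  have := eF 1 ord_max; rewrite moebius1 moebius2 => h.
  by apply: (mulfI L0); ring: h.
have R02 : lform n A B * tnth F ord_max = lform n C D * tnth F 0.
  have := eF 0 ord_max; rewrite moebius0 moebius2 => h.
  by apply: (mulfI z0); ring: h.
pose phi := dehom (@poly_y K : {rmorphism _ -> _}) x.
have phiM (p q : {mpoly K[3]}) : phi (p * q) = phi p * phi q by rewrite /phi rmorphM.
pose u := phi (tnth F ord_max); pose v := phi (tnth F 0).
have phi_size i : (msize (phi (tnth F i)) <= d.+1)%N by apply: msize_dehom_y.
have u0 : u != 0.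
  apply/eqP => h; case/eqP: F20.
  exact: (dehom_inj (@poly_y_transc K) (hd ord_max) h).
(* At z = 1 the second coordinate is y u, so [u] has degree at most d - 1: this is where the second
   row gains one degree over the first. *)
have yu : (msize (y * u) <= d.+1)%N.
  have := f_equal phi R12; rewrite !phiM /phi dehomX1 dehomX2 mul1r /= poly_yX => ->.
  exact: phi_size.
set a0 := poly_y A * x + poly_y B; set c0 := poly_y C * x + poly_y D.
have Rphi : a0 * u = c0 * v.
  have := f_equal phi R02; rewrite !phiM /phi.
  by rewrite !dehom_lform.
pose s := poly_y A * u - poly_y C * v.
have eD : poly_y (A * D - B * C) = poly_y A * poly_y D - poly_y B * poly_y C.
  by rewrite rmorphB !rmorphM.
have [e1 e2] : poly_y (A * D - B * C) * u = s * c0 /\ poly_y (A * D - B * C) * v = s * a0.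
  by rewrite eD; apply: moebius_resultant.
(* [d2] divides both linear forms and becomes the content [e]; [d1] is absorbed by [s], which leaves
   u = t c' and v = t a'. *)
have [d1 [d2 [t [c' [a' [hd12 hs hc ha]]]]]] := split_content det0 e1 e2.
have d0' : poly_y (A * D - B * C) != 0 by apply: poly_y_neq0.
have ed : poly_y (A * D - B * C) = poly_y d1 * poly_y d2 by rewrite -rmorphM -hd12.
have ut : u = t * c' by apply: (mulfI d0'); rewrite e1 ed hs hc; ring.
have vt : v = t * a' by apply: (mulfI d0'); rewrite e2 ed hs ha; ring.
have t0 : t != 0 by apply: contra u0 => /eqP h; rewrite ut h mul0r.
have d20 : d2 != 0 by apply: contra det0 => /eqP h; rewrite hd12 h mulr0.
have [A' [B' [eA eB ea]]] := linear_content d20 ha.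
have [C' [D' [eC eD' ec]]] := linear_content d20 hc.
exists d2, A', B', C', D'; split; first by split.
have [sA sB] : (size A' <= d.+1.-1)%N /\ (size B' <= d.+1)%N.
  apply: msize_linear_bound; rewrite -ea; apply: leq_trans (msize_dvdl a' t0) _.
  by rewrite -vt; apply: phi_size.
have [sC sD] : (size C' <= d.-1)%N /\ (size D' <= d)%N.
  apply: msize_linear_bound; rewrite -ec.
  apply: leq_trans (msize_dvdl c' t0) _; rewrite -ut.
  exact: msize_mulX_bound yu.
by split.
Qed.

(** If [r1] had degree at least [d], the bound on the sum would give [r2] the same degree, and the
    product would have degree at least 2d. *)
Lemma size_roots_bound d (r1 r2 tr dt : {poly K}) :
  r1 + r2 = tr -> r1 * r2 = dt -> (size tr <= d)%N -> (size dt <= (d * 2).-1)%N ->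
  r2 != 0 -> (size r1 <= d)%N.
Proof.
move=> etr edt htr hdt r20; rewrite leqNgt; apply/negP => h1.
have r10 : r1 != 0 by apply: contraTneq h1 => ->; rewrite size_poly0.
have s2 : size r2 = size r1.
  have -> : r2 = - r1 + tr by rewrite -etr; ring.
  by rewrite size_polyDl ?size_polyN // (leq_ltn_trans htr).
by move: hdt; rewrite -edt size_mul // s2; move: (size r1) h1 => k; lia.
Qed.

End DegreeLowerBound.

(** * Eigenvectors and eigenvalues of 2 by 2 matrices over a domain *)

Lemma eigenvectors2 (S : idomainType) (A B C D r1 r2 : S) :
  r1 != r2 -> (r1 - A) * (r1 - D) = B * C -> (r2 - A) * (r2 - D) = B * C ->
  exists p q r s, [/\ A * p + B * r = r1 * p, A * q + B * s = r2 * q,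
    C * p + D * r = r1 * r, C * q + D * s = r2 * s & p * s - q * r != 0].
Proof.
move=> r12 e1 e2; have d0 : r1 - r2 != 0 by rewrite subr_eq0.
have [C0|C0] := eqVneq C 0; last first.
  exists (r1 - D), (r2 - D), C, C; split.
  - by rewrite -e1; ring.
  - by rewrite -e2; ring.
  - by ring.
  - by ring.
  by rewrite (_ : _ - _ = (r1 - r2) * C) ?mulf_neq0 //; ring.
have [B0|B0] := eqVneq B 0; last first.
  exists B, B, (r1 - A), (r2 - A); split.
  - by ring.
  - by ring.
  - by rewrite mulrC -e1; ring.
  - by rewrite mulrC -e2; ring.
  by rewrite (_ : _ - _ = - (B * (r1 - r2))) ?oppr_eq0 ?mulf_neq0 //; ring.
(* The matrix is already diagonal; as the roots are distinct, they are A and D in one of the two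
   orders, and P is the identity or the swap. *)
have [e1' e2'] : ((r1 == A) || (r1 == D)) /\ ((r2 == A) || (r2 == D)).
  split; first by rewrite -[r1 == A]subr_eq0 -[r1 == D]subr_eq0 -mulf_eq0 e1 B0 mul0r.
  by rewrite -[r2 == A]subr_eq0 -[r2 == D]subr_eq0 -mulf_eq0 e2 B0 mul0r.
rewrite C0 B0; have [r1A|r1A] := eqVneq r1 A.
  have r2D : r2 = D.
    by apply/eqP; case/orP: e2' r12 => [/eqP ->|//]; rewrite r1A eqxx.
  exists 1, 0, 0, 1; rewrite r1A r2D; split; try ring.
  by rewrite !mulr1 mulr0 subr0 oner_neq0.
have r1D : r1 = D by apply/eqP; rewrite (negbTE r1A) in e1'.
have r2A : r2 = A.
  by apply/eqP; case/orP: e2' r12 => [//|/eqP ->]; rewrite r1D eqxx.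
exists 0, 1, 1, 0; rewrite r1D r2A; split; try ring.
by rewrite mulr0 mulr1 sub0r oppr_eq0 oner_neq0.
Qed.

Lemma vieta2 (S : idomainType) (A B C D r1 r2 : S) :
  r1 != r2 -> (r1 - A) * (r1 - D) = B * C -> (r2 - A) * (r2 - D) = B * C ->
  r1 + r2 = A + D /\ r1 * r2 = A * D - B * C.
Proof.
move=> r12 e1 e2.
have es : r1 + r2 = A + D.
  have d0 : r1 - r2 != 0 by rewrite subr_eq0.
  apply: (mulfI d0).
  transitivity ((r1 - A) * (r1 - D) - (r2 - A) * (r2 - D) + (r1 - r2) * (A + D)); first by ring.
  by rewrite e1 e2; ring.
split=> //; rewrite -e1 (_ : r2 = A + D - r1); first by ring.
by rewrite -es; ring.
Qed.

(** * Degree comparison over an algebraically closed field *)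

Section Main.
Variable K : closedFieldType.
Hypothesis two_neq0 : (2%:R : K) != 0.

(** The quotients r1/e and r2/e are polynomials: (r1 - r2)^2 is e^2 times the discriminant of M', so
    [e] divides r1 - r2 as well as r1 + r2, and one halves. *)
Lemma roots_content (A' B' C' D' e r1 r2 : {poly K}) : e != 0 ->
  r1 + r2 = e * (A' + D') -> r1 * r2 = e ^+ 2 * (A' * D' - B' * C') ->
  exists p q, [/\ r1 = e * p, r2 = e * q, p + q = A' + D' & p * q = A' * D' - B' * C'].
Proof.
move=> e0 es ep; have e20 : e ^+ 2 != 0 by rewrite expf_neq0.
have : e ^+ 2 %| (r1 - r2) ^+ 2.
  rewrite (_ : (r1 - r2) ^+ 2 = e ^+ 2 * ((A' + D') ^+ 2 - 4%:R * (A' * D' - B' * C'))).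
    by rewrite dvdp_mulr.
  transitivity ((r1 + r2) ^+ 2 - 4%:R * (r1 * r2)); first by ring.
  by rewrite es ep; ring.
rewrite dvdp_pexp2r // => /dvdpP[k ek].
have h2 (u : {poly K}) : 2^-1 *: (u + u) = u.
  by rewrite -mulr2n -scaler_nat scalerA mulVf // scale1r.
pose p := 2^-1 *: (A' + D' + k); pose q := 2^-1 *: (A' + D' - k).
have e1 : r1 = e * p.
  rewrite /p -scalerAr -[LHS]h2; congr (_ *: _).
  transitivity ((r1 + r2) + (r1 - r2)); first by ring.
  by rewrite es ek; ring.
have e2 : r2 = e * q.
  rewrite /q -scalerAr -[LHS]h2; congr (_ *: _).
  transitivity ((r1 + r2) - (r1 - r2)); first by ring.
  by rewrite es ek; ring.
exists p, q; split=> //.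
  by apply: (mulfI e0); rewrite -es e1 e2; ring.
by apply: (mulfI e20); rewrite -ep e1 e2; ring.
Qed.

(** Degrees enter as arbitrary values of [has_degree], so that the choice inside [deg] is met only
    in [deg_le]. *)
Theorem twist_diagonal n m (A B C D r1 r2 : {poly K}) (f : triple K) :
  (size A <= n.+1)%N -> (size B <= n.+1)%N ->
  (size C <= n.+1)%N -> (size D <= n.+1)%N ->
  (size r1 <= m.+1)%N -> (size r2 <= m.+1)%N ->
  A * D - B * C != 0 -> same_map f (moebius n A B C D) -> r1 != r2 ->
  (r1 - A) * (r1 - D) = B * C -> (r2 - A) * (r2 - D) = B * C ->
  let g := moebius m r1 0 0 r2 in
  [/\ conjugate f g, birational g &
      forall d e, has_degree f d -> has_degree g e -> (e <= d)%N].
Proof.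
move=> hA hB hC hD hr1 hr2 det0 hf r12 e1 e2 g.
have [es ep] := vieta2 r12 e1 e2.
have [r10 r20] : r1 != 0 /\ r2 != 0.
  by move: det0; rewrite -ep mulf_eq0 negb_or => /andP[].
have [p [q [r [s [h1 h2 h3 h4 hdet]]]]] := eigenvectors2 r12 e1 e2.
split.
- exact: (conjugate_moebius_diag hA hB hC hD hr1 hr2 hf h1 h2 h3 h4 hdet r10 r20).
- exists (moebius m r2 (- 0) (- 0) r1); apply: inverse_maps_sym.
  by apply: inverse_moebius; rewrite ?size_poly0 // mulr0 subr0 mulf_neq0.
move=> d e [F [fF hF _]] [G [gG hG nG]].
have MF := same_map_trans (same_map_sym hf) fF.
have [a [A' [B' [C' [D' [[eA eB eC eD] [sA sB sC sD]]]]]]] :=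
  degree_moebius_bound hA hB hC hD det0 MF hF.
have a0 : a != 0.
  by apply: contra det0 => /eqP a0; rewrite eA eB a0 !mul0r subrr.
have [||p' [q' [ep' eq' es' em']]] := @roots_content A' B' C' D' a r1 r2 a0.
- by rewrite es eA eD; ring.
- by rewrite ep eA eB eC eD; ring.
have [p'0 q'0] : p' != 0 /\ q' != 0.
  by split; [apply: contra r10 | apply: contra r20] => /eqP h; rewrite ?ep' ?eq' h mulr0.
have str : (size (A' + D')%R <= d)%N.
  by apply: leq_trans (size_polyD _ _) _; rewrite geq_max sA.
(* The better bound on [C'] compensates the weaker one on [B']: both products have degree at most 2d
   - 2. *)
have sdet : (size (A' * D' - B' * C')%R <= (d * 2).-1)%N.
  apply: leq_trans (size_polyD _ _) _; rewrite size_polyN geq_max; apply/andP; split.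
    apply: leq_trans (size_polyMleq _ _) _.
    by move: (size A') (size D') sA sD => i j {str}; clear; lia.
  apply: leq_trans (size_polyMleq _ _) _.
  by move: (size B') (size C') sB sC => i j; clear; lia.
have sp := size_roots_bound es' em' str sdet q'0.
have sq := size_roots_bound (etrans (addrC _ _) es') (etrans (mulrC _ _) em') str sdet p'0.
exact: (degree_moebius_diag hr1 hr2 r10 r20 gG hG nG ep' eq' sp sq).
Qed.

End Main.

(** * The field of rational functions *)

Section FractionField.
Variables (K Ky : fieldType) (j : {rmorphism {poly K} -> Ky}).

(** For [j] the embedding of K[y] in K(y) this unfolds to [in_x] after [in_y], so results transfer
    to the original definitions by conversion. *)
Definition frac_emb (p : {poly K}) : {fraction {poly Ky}} := tofrac (j p)%:P.

HB.instance Definition _ := GRing.RMorphism.copy frac_emb (@tofrac {poly Ky} \o (polyC \o j)).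

Hypothesis j_inj : injective j.

Lemma frac_emb_transc (q : {poly {poly K}}) :
  (map_poly frac_emb q).[tofrac 'X] = 0 -> q = 0.
Proof.
have -> : map_poly frac_emb q = map_poly (@tofrac {poly Ky}) (map_poly polyC (map_poly j q)).
  by rewrite -!map_poly_comp; apply: eq_map_poly.
rewrite horner_map /= -[_.['X]]/(map_poly j q \Po 'X) comp_polyXr => /eqP.
rewrite tofrac_eq0 => /eqP h; apply: (map_inj_poly j_inj (rmorph0 j)).
by rewrite h map_poly0.
Qed.

(** Serves to cancel the 2 in (Tr + delta) / (Tr - delta). *)
Lemma frac_emb_ratio (c r1 r2 : {poly K}) : c != 0 ->
  j (c * r1) / j (c * r2) = j r1 / j r2.
Proof.
move=> c0; have jc : j c != 0.
  by apply: contra c0 => /eqP h; apply/eqP/j_inj; rewrite h rmorph0.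
by rewrite !rmorphM /= -mulf_div divff // mul1r.
Qed.

Lemma affine_form_diag m (r1 r2 : {poly K}) :
  (size r1 <= m.+1)%N -> (size r2 <= m.+1)%N -> r2 != 0 ->
  affine_form frac_emb (tofrac 'X) (moebius m r1 0 0 r2)
    (tofrac (j r1 / j r2)%:P * tofrac 'X) (frac_emb 'X).
Proof.
move=> hr1 hr2 r20; pose e : {rmorphism Ky -> {fraction {poly Ky}}} := @tofrac {poly Ky} \o polyC.
have -> : tofrac (j r1 / j r2)%:P * tofrac 'X =
    (frac_emb r1 * tofrac 'X + frac_emb 0) / (frac_emb 0 * tofrac 'X + frac_emb r2).
  rewrite -[tofrac _%:P]/(e (j r1 / j r2)) (fmorph_div e) rmorph0 mul0r addr0 add0r.
  by rewrite mulrAC.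
by apply: (affine_form_moebius frac_emb_transc); rewrite ?size_poly0 // => -[_ /eqP]; apply/negP.
Qed.

End FractionField.

Section Matrix22.
Variable S : comNzRingType.
Implicit Types (a b c d r : S).

Lemma mxtrace_mx22 a b c d : \tr (mx22 a b c d) = a + d.
Proof. by rewrite /mxtrace !big_ord_recl big_ord0 !mxE /= addr0. Qed.

Lemma det_mx22E a b c d : \det (mx22 a b c d) = a * d - b * c.
Proof.
rewrite (expand_det_row _ ord0) !big_ord_recl big_ord0 /cofactor !det_mx11 !mxE /=.
by rewrite /bump /= expr0 expr1; ring.
Qed.

Lemma root_chi_mx22 a b c d r : root (chi (mx22 a b c d)) r -> (r - a) * (r - d) = b * c.
Proof.
rewrite /chi mxtrace_mx22 det_mx22E /root !(hornerD, hornerN, hornerM, hornerC, hornerXn, hornerX) => /eqP h.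
by apply/eqP; rewrite -subr_eq0 -h; apply/eqP; ring.
Qed.

End Matrix22.

Section Complex.
Variable R : realType.

Definition Cx : closedFieldType := R[i].

Definition iny : {poly Cx} -> ratfun_y R := @in_y R.
HB.instance Definition _ := GRing.RMorphism.copy iny (@tofrac {poly Cx}).

Lemma iny_inj : injective iny.
Proof. by move=> p q /eqP; rewrite /iny /in_y tofrac_eq => /eqP. Qed.

Lemma Cx_two_neq0 : (2%:R : Cx) != 0.
Proof. by rewrite (pnatr_eq0 R[i] 2). Qed.

Lemma deg_le (f g : triple Cx) : rational_map f -> rational_map g ->
  (forall d e, has_degree f d -> has_degree g e -> (e <= d)%N) ->
  (@deg R g <= @deg R f)%N.
Proof.
move=> /has_degree_exists hf /has_degree_exists hg; apply.
  exact: (classical_sets.xgetPex 0%N hf).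
exact: (classical_sets.xgetPex 0%N hg).
Qed.

Lemma twist_diagonal_complex (A B C D r1 r2 : {poly Cx}) (f : triple Cx) :
  A * D - B * C != 0 -> birational f ->
  affine_form (frac_emb iny) (tofrac 'X) f
    ((frac_emb iny A * tofrac 'X + frac_emb iny B) /
     (frac_emb iny C * tofrac 'X + frac_emb iny D)) (frac_emb iny 'X) ->
  r1 != r2 -> (r1 - A) * (r1 - D) = B * C -> (r2 - A) * (r2 - D) = B * C ->
  exists g : triple Cx,
    [/\ affine_form (frac_emb iny) (tofrac 'X) g
          (tofrac (iny r1 / iny r2)%:P * tofrac 'X) (frac_emb iny 'X),
        conjugate f g, birational g & (@deg R g <= @deg R f)%N].
Proof.
move=> det0 bf hf r12 e1 e2.
have [r10 r20] : r1 != 0 /\ r2 != 0.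
  by have [_ h] := vieta2 r12 e1 e2; move: det0; rewrite -h mulf_eq0 negb_or => /andP[].
pose n := (size A + size B + size C + size D + size r1 + size r2)%N.
have [hA hB] : (size A <= n.+1)%N /\ (size B <= n.+1)%N by rewrite /n; split; lia.
have [hC hD] : (size C <= n.+1)%N /\ (size D <= n.+1)%N by rewrite /n; split; lia.
have [hr1 hr2] : (size r1 <= n.+1)%N /\ (size r2 <= n.+1)%N by rewrite /n; split; lia.
have nCD : ~ (C = 0 /\ D = 0).
  by case=> C0 D0; rewrite C0 D0 !mulr0 subrr eqxx in det0.
have rf : rational_map f by case: bf => ? [].
(* [f] is given only through its affine form; it is replaced here by an explicit triple. *)
have fM : same_map f (moebius n A B C D).
  apply: (affine_form_same (frac_emb_transc iny_inj) rf _ hf).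
    exact: moebius_rational.
  exact: (affine_form_moebius (frac_emb_transc iny_inj)).
have [cg bg dg] :=
  twist_diagonal Cx_two_neq0 hA hB hC hD hr1 hr2 det0 fM r12 e1 e2.
exists (moebius n r1 0 0 r2); split; [|exact: cg|exact: bg|].
  exact: (affine_form_diag iny_inj).
by apply: (deg_le rf _ dg); case: bg => ? [].
Qed.

End Complex.
End FieldMaps.

Theorem corollary4 (R : realType) (A B C D : {poly R[i]}) (f : triple R)
    (hdet : A * D - B * C != 0)
    (hf : affine_form f
            ((in_x (in_y A) * xvar R + in_x (in_y B)) /
             (in_x (in_y C) * xvar R + in_x (in_y D))) (yvar R))
    (htwist : jonquieres_twist f)
    (hroots : exists r1 r2 : {poly R[i]},
        [/\ r1 != r2, root (chi (mx22 A B C D)) r1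
          & root (chi (mx22 A B C D)) r2]) :
  let M := mx22 A B C D in
  (exists g : triple R,
      [/\ conjugate f g, in_Jm g & (deg g <= deg f)%N]) /\
  ((exists delta : {poly R[i]}, delta ^+ 2 = \tr M ^+ 2 - 4%:R * \det M) /\
   (forall delta : {poly R[i]}, delta ^+ 2 = \tr M ^+ 2 - 4%:R * \det M ->
      exists g : triple R,
        [/\ affine_form g
              (in_x (in_y (\tr M + delta) / in_y (\tr M - delta)) * xvar R)
              (yvar R),
            conjugate f g, in_Jm g & (deg g <= deg f)%N])).
Proof.
have [bf _] := htwist; move=> M; rewrite {}/M FieldMaps.mxtrace_mx22 FieldMaps.det_mx22E.
have [r1 [r2 [r12 /FieldMaps.root_chi_mx22 e1 /FieldMaps.root_chi_mx22 e2]]] := hroots.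
(* Stated for an ordered pair of roots, because the sign of [delta] decides which root is the
   numerator. *)
have main s1 s2 : s1 != s2 -> (s1 - A) * (s1 - D) = B * C -> (s2 - A) * (s2 - D) = B * C ->
  exists g : triple R, [/\ affine_form g (in_x (in_y s1 / in_y s2) * xvar R) (yvar R),
    conjugate f g, in_Jm g & (deg g <= deg f)%N].
  move=> s12 h1 h2.
  have [s10 s20] : s1 != 0 /\ s2 != 0.
    by have [_ h] := FieldMaps.vieta2 s12 h1 h2; move: hdet; rewrite -h mulf_eq0 negb_or => /andP[].
  have [g [ag cg bg dg]] := @FieldMaps.twist_diagonal_complex R A B C D s1 s2 f hdet bf hf s12 h1 h2.
  exists g; split; [exact: ag|exact: cg| |exact: dg].
  split; first exact: bg.
  exists (in_y s1 / in_y s2); split; last exact: ag.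
  by rewrite mulf_neq0 ?invr_eq0 // /in_y tofrac_eq0.
have [es ep] := FieldMaps.vieta2 r12 e1 e2.
split; first by have [g [_ ? ? ?]] := main _ _ r12 e1 e2; exists g.
have disc : (A + D) ^+ 2 - 4%:R * (A * D - B * C) = (r1 - r2) ^+ 2.
  by rewrite -es -ep; ring.
split; first by exists (r1 - r2).
have n2 : (2%:R : {poly R[i]}) != 0 by rewrite -polyC_natr polyC_eq0 (FieldMaps.Cx_two_neq0 R).
(* [delta] is r1 - r2 up to sign, so trace plus and minus [delta] are twice the two roots. *)
move=> delta; rewrite disc => /eqP; rewrite eqf_sqr => /orP[] /eqP ->.
  have [g hg] := main _ _ r12 e1 e2; exists g.
  rewrite -es (_ : r1 + r2 + (r1 - r2) = 2%:R * r1); last by ring.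
  rewrite (_ : r1 + r2 - (r1 - r2) = 2%:R * r2); last by ring.
  by have := FieldMaps.frac_emb_ratio (@FieldMaps.iny_inj R) r1 r2 n2; rewrite /FieldMaps.iny => ->.
(* The opposite sign exchanges the roots and gives the map (r2/r1 x, y). *)
rewrite eq_sym in r12.
have [g hg] := main _ _ r12 e2 e1; exists g.
rewrite -es (_ : r1 + r2 + - (r1 - r2) = 2%:R * r2); last by ring.
rewrite (_ : r1 + r2 - - (r1 - r2) = 2%:R * r1); last by ring.
by have := FieldMaps.frac_emb_ratio (@FieldMaps.iny_inj R) r2 r1 n2; rewrite /FieldMaps.iny => ->.
Qed.
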